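(* The maximum cardinality of a biangular line system in $\mathbb{R}^3$ is $10$. The maximum configuration is unique (up to isometry of the line system): every set of $10$ unit vectors in $\mathbb{R}^3$ spanning a biangular line system has, after a suitable ordering of the vectors and replacing some of them by their negatives, the Gram matrix $C(1/3,\sqrt5/3)$, where \[ C(\alpha,\beta)=\begin{bmatrix} 1 & \alpha & \alpha & \alpha & \alpha & \alpha & \alpha & \beta & \beta & \beta \\ \alpha & 1 & \alpha & -\alpha & -\alpha & \beta & -\beta & \alpha & -\alpha & \beta \\ \alpha & \alpha & 1 & \beta & -\beta & -\alpha & -\alpha & -\alpha & \alpha & \beta \\ \alpha & -\alpha & \beta & 1 & -\alpha & -\beta & \alpha & -\alpha & \beta & \alpha \\ \alpha & -\alpha & -\beta & -\alpha & 1 & \alpha & \beta & \beta & \alpha & -\alpha \\ \alpha & \beta & -\alpha & -\beta & \alpha & 1 & -\alpha & \beta & -\alpha & \alpha \\ \alpha & -\beta & -\alpha & \alpha & \beta & -\alpha & 1 & \alpha & \beta & -\alpha \\ \beta & \alpha & -\alpha & -\alpha & \beta & \beta & \alpha & 1 & \alpha & \alpha \\ \beta & -\alpha & \alpha & \beta & \alpha & -\alpha & \beta & \alpha & 1 & \alpha \\ \beta & \beta & \beta & \alpha & -\alpha & \alpha & -\alpha & \alpha & \alpha & 1 \end{bmatrix}, \] and this Gram matrix corresponds to the main diagonals of the platonic (regular) dodecahedron, i.e., the $10$ lines through pairs of antipodal vertices.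
   Context: For a finite set $\mathcal{X}\subset\mathbb{R}^d$ of unit vectors put $A(\mathcal{X}):=\{\langle x,x'\rangle\colon x\neq x';\ x,x'\in\mathcal{X}\}$. The set $\mathcal{X}$ spans a system of biangular lines (the lines through the origin in the directions $x\in\mathcal{X}$) if $-1\notin A(\mathcal{X})$ and $|\{\gamma^2\colon\gamma\in A(\mathcal{X})\}|\leq 2$. The cardinality of the line system is $|\mathcal{X}|$. Line systems are considered up to applying an orthogonal transformation of $\mathbb{R}^d$ and replacing vectors $x\in\mathcal{X}$ by $-x$. The Gram matrix of $\mathcal{X}=\{x_1,\dots,x_n\}$ is $[\langle x_i,x_j\rangle]_{i,j=1}^n$. *)

(* Defs.v *)
From HB Require Import structures.
From mathcomp Require Import all_boot all_order all_algebra.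
From mathcomp Require Import finmap reals.

Set Implicit Arguments.
Unset Strict Implicit.
Unset Printing Implicit Defensive.

Import Order.TTheory GRing.Theory Num.Theory.

Local Open Scope fset_scope.
Local Open Scope ring_scope.

Definition dot (R : realType) (d : nat) (u v : 'rV[R]_d) : R :=
  (u *m v^T) 0 0.

Definition inner_products (R : realType) (d : nat) (X : {fset 'rV[R]_d})
    : {fset R} :=
  [fset dot p.1 p.2 | p in [fset q in X `*` X | q.1 != q.2]].

Definition biangular (R : realType) (d : nat) (X : {fset 'rV[R]_d}) : Prop :=
  [/\ forall x, x \in X -> dot x x = 1,
      -1 \notin inner_products X
    & (#|` [fset g ^+ 2 | g in inner_products X]| <= 2)%N].

Definition gram (R : realType) (d n : nat) (x : 'I_n -> 'rV[R]_d) : 'M[R]_n :=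
  \matrix_(i, j) dot (x i) (x j).

(* Vectors are rows, so the orthogonal matrix Q acts on the right. *)
Definition isometric_systems (R : realType) (d : nat)
    (X Y : {fset 'rV[R]_d}) : Prop :=
  exists (Q : 'M[R]_d) (s : 'rV[R]_d -> bool),
    Q *m Q^T = 1%:M /\ Y = [fset (-1) ^+ s x *: (x *m Q) | x in X].

Definition Cmx (R : realType) (a b : R) : 'M[R]_10 :=
  \matrix_(i < 10, j < 10) nth 0 (nth [::]
    [:: [::   1;   a;   a;   a;   a;   a;   a;   b;   b;   b];
        [::   a;   1;   a; - a; - a;   b; - b;   a; - a;   b];
        [::   a;   a;   1;   b; - b; - a; - a; - a;   a;   b];
        [::   a; - a;   b;   1; - a; - b;   a; - a;   b;   a];
        [::   a; - a; - b; - a;   1;   a;   b;   b;   a; - a];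
        [::   a;   b; - a; - b;   a;   1; - a;   b; - a;   a];
        [::   a; - b; - a;   a;   b; - a;   1;   a;   b; - a];
        [::   b;   a; - a; - a;   b;   b;   a;   1;   a;   a];
        [::   b; - a;   a;   b;   a; - a;   b;   a;   1;   a];
        [::   b;   b;   b;   a; - a;   a; - a;   a;   a;   1]] i) j.

Definition vec3 (R : realType) (x y z : R) : 'rV[R]_3 :=
  \row_(i < 3) nth 0 [:: x; y; z] i.

Definition golden (R : realType) : R := (1 + Num.sqrt 5) / 2.

(* The 20 vertices of the regular dodecahedron with centre 0, edge length
   2 / golden and circumradius sqrt 3: (+-1, +-1, +-1) and the cyclic shifts of
   (0, +-1/golden, +-golden). *)
Definition dodecahedron_vertices (R : realType) : seq 'rV[R]_3 :=
  let g := golden R in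
  [seq vec3 ((-1) ^+ t.1.1) ((-1) ^+ t.1.2) ((-1) ^+ t.2)
     | t : bool * bool * bool]
  ++ [seq vec3 0 ((-1) ^+ t.1 / g) ((-1) ^+ t.2 * g) | t : bool * bool]
  ++ [seq vec3 ((-1) ^+ t.2 * g) 0 ((-1) ^+ t.1 / g) | t : bool * bool]
  ++ [seq vec3 ((-1) ^+ t.1 / g) ((-1) ^+ t.2 * g) 0 | t : bool * bool].

(* The antipode of a vertex v is the vertex - v, and the line through v and - v
   is the one-dimensional subspace <[v]>. *)
Definition dodecahedron_diagonals (R : realType) : {fset {vspace 'rV[R]_3}} :=
  [fset <[v]>%VS | v in dodecahedron_vertices R].

(* Main.v *)
(** By the bound R(K4 - e, K4 - e) <= 10, colouring the pairs of ten lines by their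
    angle produces four of them, five of whose six angles agree.  After switching,
    three of them form a frame x1, x2, x3 with all inner products equal to some al, and
    the fourth ties be to al: the pairs (al, be) lie on two rational curves (with
    parameter t = al, respectively t = 2 al / (1 + be)), or al = -1/3 (a regular
    tetrahedron), or al^2 = 1/5 (four diagonals of the icosahedron; there any further
    suitable line makes al a polynomial in t = be).

    Every other line is determined by its three inner products +-al, +-be with the
    frame, so it is one of 32 candidates.  That a candidate is a unit vector, and that
    two candidates make an admissible angle, are polynomial equations in t.  A search
    over sets of candidates, maintaining the gcd of these polynomials, shows that seven
    candidates never coexist, except when al = -1/3 and be^2 = 5/9; there exactly two
    sets survive, and both give C up to order and signs.  Equality of Gram matrices then
    yields the isometries. *)

Require Import Defs.
From Stdlib Require Import ZArith.
From HB Require Import structures.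
From mathcomp Require Import all_boot all_order all_algebra.
From mathcomp Require Import finmap reals.
From mathcomp Require Import ssrZ zify ring lra.

Set Implicit Arguments.
Unset Strict Implicit.
Unset Printing Implicit Defensive.

Import Order.TTheory GRing.Theory Num.Theory.

Local Open Scope fset_scope.
Local Open Scope ring_scope.

Delimit Scope Z_scope with ZZ.

(** * Integer polynomials in one parameter *)

(** Coefficients are binary integers, so that the searches can run by computation; this embeds them
    in [R]. *)
Definition zr (R : numDomainType) (z : Z) : R := (int_of_Z z)%:~R.

Fixpoint ev (R : numDomainType) (p : seq Z) (t : R) : R :=
  if p is a :: q then zr R a + t * ev q t else 0.

Fixpoint padd (p q : seq Z) : seq Z :=
  match p, q with
  | [::], _ => q
  | _, [::] => p
  | a :: p', b :: q' => Z.add a b :: padd p' q'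
  end.

Definition pscale (c : Z) (p : seq Z) : seq Z := map (Z.mul c) p.

Definition psub (p q : seq Z) : seq Z := padd p (pscale (-1)%ZZ q).

Fixpoint pmul (p q : seq Z) : seq Z :=
  if p is a :: p' then padd (pscale a q) (0%ZZ :: pmul p' q) else [::].

Definition pshift (n : nat) (p : seq Z) : seq Z := ncons n 0%ZZ p.

(** Without trailing zeros, [last] is the leading coefficient and [size] measures the degree. *)
Definition pnorm (p : seq Z) : seq Z :=
  foldr (fun a r => if r is [::] then (if Z.eqb a 0%ZZ then [::] else [:: a])
                    else a :: r) [::] p.

(* The routines below run on fuel and need no correctness proof: a remainder vanishes
   wherever its two arguments do, and quotients are checked after the fact. *)
Definition pprim (p : seq Z) : seq Z :=
  let q := pnorm p in
  let c := foldr Z.gcd 0%ZZ q in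
  let r := map (fun a => Z.div a c) q in
  if ~~ Z.eqb c 0%ZZ && (pscale c r == q) then r else q.

Fixpoint prem (n : nat) (f g : seq Z) : seq Z :=
  if n is n'.+1 then
    if (size f < size g)%N then f else
    prem n' (pprim (psub (pscale (last 0%ZZ g) f)
                     (pshift (size f - size g) (pscale (last 0%ZZ f) g)))) g
  else f.

Fixpoint pgcd (n : nat) (f g : seq Z) : seq Z :=
  if n is n'.+1 then
    if g is [::] then f else pgcd n' g (prem (size f).+1 f g)
  else f.

(** Pseudo-division: throughout, [c] times the original dividend is [q] times [g] plus the current
    [f]. *)
Fixpoint pdiv (n : nat) (f g q : seq Z) (c : Z) : Z * seq Z :=
  if n is n'.+1 then
    if (size f < size g)%N then (c, q) else
    let a := last 0%ZZ g in
    let b := last 0%ZZ f in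
    let s := (size f - size g)%N in
    pdiv n' (pnorm (psub (pscale a f) (pshift s (pscale b g)))) g
      (padd (pscale a q) (pshift s [:: b])) (Z.mul a c)
  else (c, q).

Fixpoint strip (n : nat) (f g : seq Z) : seq Z :=
  if n is n'.+1 then
    let r := pdiv (size g).+1 g f [::] 1%ZZ in
    if ~~ Z.eqb r.1 0%ZZ && (pnorm (psub (pmul r.2 f) (pscale r.1 g)) == [::])
    then strip n' f (pprim r.2) else g
  else g.

Section Ev.
Variables (R : numDomainType) (t : R).
Implicit Types (p q f g : seq Z) (c : Z).

Lemma zrD a b : zr R (Z.add a b) = zr R a + zr R b.
Proof.
by rewrite /zr -rmorphD /=; congr (_%:~R); rewrite -[Z.add a b]/(a + b) rmorphD.
Qed.

Lemma zrM a b : zr R (Z.mul a b) = zr R a * zr R b.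
Proof.
by rewrite /zr -rmorphM /=; congr (_%:~R); rewrite -[Z.mul a b]/(a * b) rmorphM.
Qed.

Lemma zr_eq0 c : (zr R c == 0) = (Z.eqb c 0%ZZ).
Proof.
by rewrite /zr intr_eq0 -[0]/(int_of_Z 0) (inj_eq (can_inj int_of_ZK)).
Qed.

Lemma ev_add p q : ev (padd p q) t = ev p t + ev q t.
Proof.
elim: p q => [|a p IH] [|b q] /=; rewrite ?add0r ?addr0 // zrD IH; ring.
Qed.

Lemma ev_scale c p : ev (pscale c p) t = zr R c * ev p t.
Proof. by elim: p => [|a p IH] /=; rewrite ?mulr0 // zrM IH; ring. Qed.

Lemma ev_sub p q : ev (psub p q) t = ev p t - ev q t.
Proof. by rewrite ev_add ev_scale /zr /= mulN1r. Qed.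

Lemma ev_mul p q : ev (pmul p q) t = ev p t * ev q t.
Proof.
by elim: p => [|a p IH] /=; rewrite ?mul0r // ev_add ev_scale /= IH /zr /=; ring.
Qed.

Lemma ev_shift n p : ev (pshift n p) t = t ^+ n * ev p t.
Proof.
by elim: n => [|n IH] /=; rewrite ?mul1r // -/(pshift n p) IH /zr /= exprS; ring.
Qed.

Lemma ev_norm p : ev (pnorm p) t = ev p t.
Proof.
elim: p => //= a p; rewrite -/(pnorm p).
case: (pnorm p) => /= [<-|b r <- //].
by case: ifP => [|_ //]; rewrite -zr_eq0 => /eqP /= ->; rewrite mulr0 addr0.
Qed.

Lemma ev_prim p : ev p t = 0 -> ev (pprim p) t = 0.
Proof.
rewrite -ev_norm /pprim; case: ifP => // /andP[c0 /eqP h]; rewrite -{1}h => /eqP.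
by rewrite ev_scale mulf_eq0 zr_eq0 (negPf c0) => /eqP.
Qed.

Lemma ev_rem n f g : ev f t = 0 -> ev g t = 0 -> ev (prem n f g) t = 0.
Proof.
move=> + g0; elim: n f => //= n IH f f0; case: ifP => // _; apply: IH.
by apply: ev_prim; rewrite ev_sub ev_shift !ev_scale f0 g0 !mulr0 subrr.
Qed.

Local Arguments prem : simpl never.

Lemma ev_gcd n f g : ev f t = 0 -> ev g t = 0 -> ev (pgcd n f g) t = 0.
Proof.
elim: n f g => //= n IH f [|b g] // f0 g0.
by apply: IH => //; apply: ev_rem.
Qed.

(** An accepted quotient times [f] is a nonzero multiple of [g], so it vanishes at [t] because [f]
    does not. *)
Lemma ev_strip n f g : ev f t != 0 -> ev g t = 0 -> ev (strip n f g) t = 0.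
Proof.
move=> f0; elim: n g => //= n IH g g0; case: ifP => // /andP[c0 /eqP h].
apply: IH; apply: ev_prim.
have := ev_norm (psub (pmul (pdiv (size g).+1 g f [::] 1%ZZ).2 f)
                   (pscale (pdiv (size g).+1 g f [::] 1%ZZ).1 g)).
rewrite h ev_sub ev_mul ev_scale g0 mulr0 subr0 => /esym/eqP.
by rewrite mulf_eq0 (negPf f0) orbF => /eqP.
Qed.

End Ev.

Local Arguments pgcd : simpl never.
Local Arguments strip : simpl never.

(** * Exhaustive search for systems extending an equiangular triple *)

(* One pair per inner product with the frame vectors: the first bit selects be
   (true) or al (false), the second the sign, which is + for the first inner product
   as lines are considered. *)
Definition code : Type := (bool * bool) * (bool * bool) * (bool * bool).

Definition codes : seq code :=
  let v := [:: (false, false); (false, true); (true, false); (true, true)] in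
  [seq (c, d) | c <- [seq (a, b) | a <- [:: (true, false); (false, false)], b <- v],
                d <- v].

Definition pvec : Type := seq Z * seq Z * seq Z.

Section Search.
(* al = A(t) / D(t) and be = B(t) / D(t); no polynomial of fs vanishes at t. *)
Variables (D A B : seq Z) (fs : seq (seq Z)).

Definition pval (c : bool * bool) : seq Z :=
  pscale (if c.2 then (-1)%ZZ else 1%ZZ) (if c.1 then B else A).

Definition pcode (c : code) : pvec := (pval c.1.1, pval c.1.2, pval c.2).

(** At [t] this is D^2 (1 - al)(1 + 2 al): up to D^2, the Gram determinant of the frame divided by 1
    - al. *)
Definition pk : seq Z := pmul (psub D A) (padd D (padd A A)).

(* pk(t) * D(t) times the inner product of two vectors, by [frame_dot]. *)
Definition pip (u v : pvec) : seq Z :=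
  psub (pmul (padd D (padd A A))
          (padd (padd (pmul u.1.1 v.1.1) (pmul u.1.2 v.1.2)) (pmul u.2 v.2)))
    (pmul A (pmul (padd (padd u.1.1 u.1.2) u.2) (padd (padd v.1.1 v.1.2) v.2))).

Definition pnrm (c : code) : seq Z :=
  psub (pip (pcode c) (pcode c)) (pmul pk D).

Definition psq (p : seq Z) : seq Z := pmul p p.

(** The two factors compare the squared inner product with al^2 and be^2, all scaled by the square
    of pk(t) D(t). *)
Definition ppair (c d : code) : seq Z :=
  let s := psq (pip (pcode c) (pcode d)) in
  pmul (psub s (psq (pmul pk A))) (psub s (psq (pmul pk B))).

(** Every admissible root of [g] at which [c] can join [ch] is a root of the result. Factors from
    [fs] are divided out, so a nonzero constant leaves no parameter. *)
Definition restrict (g : seq Z) (ch : seq code) (c : code) : seq Z :=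
  foldr (strip 50)
    (foldl (fun h d => pgcd 100 h (pprim (ppair c d)))
       (pgcd 100 g (pprim (pnrm c))) ch) fs.

Definition pconst (p : seq Z) : bool := if p is [:: a] then ~~ Z.eqb a 0%ZZ else false.

(* The sets of at least need compatible codes of cs, together with those in ch,
   that are possible at some root of g. *)
Fixpoint search (cs : seq code) (need : nat) (g : seq Z) (ch : seq code)
    : seq (seq code) :=
  if (size cs < need)%N then [::] else
  if cs is c :: cs' then
    (let h := restrict g ch c in
     if pconst h then [::] else search cs' need.-1 h (c :: ch))
    ++ search cs' need g ch
  else [:: ch].

End Search.


(** * Soundness: the search misses no set of coexisting codes *)

Section SearchSound.
Variables (R : numDomainType) (t : R) (D A B : seq Z) (fs : seq (seq Z)).
Variable good : pred code.
Hypothesis fsP : forall f, f \in fs -> ev f t != 0.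
Hypothesis nrmP : forall c, good c -> ev (pnrm D A B c) t = 0.
Hypothesis pairP : forall c d, good c -> good d -> c != d ->
  ev (ppair D A B c d) t = 0.

Lemma ev_restrict g ch c : ev g t = 0 -> good c -> all good ch ->
  c \notin ch -> ev (restrict D A B fs g ch c) t = 0.
Proof.
move=> g0 gc gch cch; rewrite /restrict.
set h := foldl _ _ _.
have: ev h t = 0.
  rewrite {}/h; have: ev (pgcd 100 g (pprim (pnrm D A B c))) t = 0.
    by apply: ev_gcd => //; apply/ev_prim/nrmP.
  elim: ch gch cch (pgcd _ _ _) => //= d ch IH /andP[gd gch].
  rewrite inE negb_or => /andP[cd cch] h h0; apply: IH => //.
  by apply: ev_gcd => //; apply/ev_prim/pairP.
elim: fs fsP => //= f gs IH hf h0; apply: ev_strip; first by apply: hf; rewrite mem_head.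
by apply: IH => // f' f'gs; apply: hf; rewrite inE f'gs orbT.
Qed.

(** The branch taking exactly the good codes is never cut: enough of them remain for the size test,
    and [t] is a root of every polynomial on the way, so none is a nonzero constant. [catrev]
    appears because chosen codes are pushed onto [ch]. *)
Lemma search_mem cs need g ch : uniq cs -> all good ch ->
  (forall c, c \in ch -> c \notin cs) -> ev g t = 0 ->
  (need <= count good cs)%N ->
  catrev (filter good cs) ch \in search D A B fs cs need g ch.
Proof.
elim: cs need g ch => [|c cs IH] need g ch /=.
  by move=> _ _ _ _; rewrite leqn0 => /eqP ->; rewrite mem_head.
move=> /andP[ccs ucs] gch chcs g0 hn; have -> : ((size cs).+1 < need)%N = false.
  apply: negbTE; rewrite -leqNgt (leq_trans hn) //.
  by rewrite -add1n leq_add ?count_size // leq_b1.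
have chcs' d : d \in ch -> d \notin cs.
  by move=> /chcs; rewrite inE negb_or => /andP[].
rewrite mem_cat; case: ifP hn => [gc|_]; last first.
  by rewrite add0n => hn; rewrite (IH need) ?orbT.
rewrite add1n => hn.
have cch : c \notin ch.
  by apply/negP => /chcs; rewrite mem_head.
have r0 := ev_restrict g0 gc gch cch.
have -> : pconst (restrict D A B fs g ch c) = false.
  apply/negP; rewrite /pconst; case: (restrict _ _ _ _ _ _ _) r0 => [|a []] //=.
  by rewrite mulr0 addr0 => /eqP; rewrite zr_eq0 => ->.
rewrite /= IH //=; first by rewrite gc.
  by move=> d; rewrite inE => /orP[/eqP->|/chcs'].
by case: need hn.
Qed.

End SearchSound.

(** * Vectors in three-space and equiangular frames *)

Section Dot.
Variables (R : realType).
Implicit Types u v w x y z : 'rV[R]_3.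

Lemma dotE u v : dot u v = u 0 0 * v 0 0 + u 0 1 * v 0 1 + u 0 2 * v 0 2.
Proof.
rewrite /dot !mxE !big_ord_recl big_ord0 !mxE addr0 addrA.
by congr (_ * _ + _ * _ + _ * _); congr (_ _ _); apply: val_inj.
Qed.

Lemma dotC u v : dot u v = dot v u.
Proof. by rewrite !dotE; ring. Qed.

Lemma dotZl a u v : dot (a *: u) v = a * dot u v.
Proof. by rewrite !dotE !mxE; ring. Qed.

Lemma dotZr a u v : dot u (a *: v) = a * dot u v.
Proof. by rewrite dotC dotZl dotC. Qed.

Lemma dotNl u v : dot (- u) v = - dot u v.
Proof. by rewrite -scaleN1r dotZl mulN1r. Qed.

Lemma dotNr u v : dot u (- v) = - dot u v.
Proof. by rewrite dotC dotNl dotC. Qed.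

Lemma dot_unit_eq u v : dot u u = 1 -> dot v v = 1 -> dot u v = 1 -> u = v.
Proof.
rewrite !dotE => hu hv huv.
have: (u 0 0 - v 0 0) ^+ 2 + (u 0 1 - v 0 1) ^+ 2 + (u 0 2 - v 0 2) ^+ 2 = 0.
  by lra.
move=> /eqP; rewrite paddr_eq0 ?addr_ge0 ?sqr_ge0 // paddr_eq0 ?sqr_ge0 //.
rewrite !sqrf_eq0 !subr_eq0 => /andP[/andP[/eqP h0 /eqP h1] /eqP h2].
apply/rowP => -[[|[|[|i]]] hi] //.
- by move: h0; congr (_ = _); congr (_ _ _); apply: val_inj.
- by move: h1; congr (_ = _); congr (_ _ _); apply: val_inj.
- by move: h2; congr (_ = _); congr (_ _ _); apply: val_inj.
Qed.

Lemma dot_unit_lt1 u v : dot u u = 1 -> dot v v = 1 -> u != v -> u != - v ->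
  dot u v ^+ 2 < 1.
Proof.
move=> hu hv uv uNv.
have cs : dot u v ^+ 2 <= 1.
  (* Lagrange's identity yields Cauchy-Schwarz; equality would make [u] and [v] equal or
     opposite. *)
  have h : 0 <= (u 0 0 * v 0 1 - u 0 1 * v 0 0) ^+ 2
    + (u 0 0 * v 0 2 - u 0 2 * v 0 0) ^+ 2 + (u 0 1 * v 0 2 - u 0 2 * v 0 1) ^+ 2.
    by rewrite !addr_ge0 ?sqr_ge0.
  have e : (u 0 0 * v 0 1 - u 0 1 * v 0 0) ^+ 2
    + (u 0 0 * v 0 2 - u 0 2 * v 0 0) ^+ 2 + (u 0 1 * v 0 2 - u 0 2 * v 0 1) ^+ 2
    = dot u u * dot v v - dot u v ^+ 2 by rewrite !dotE; ring.
  by move: h; rewrite e hu hv mulr1 subr_ge0.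
rewrite lt_neqAle cs andbT -subr_eq0 -[1](expr1n R 2) subr_sqr mulf_eq0 subr_eq0 addr_eq0.
apply/negP => /orP[/eqP/dot_unit_eq h|/eqP h].
  by move: uv; rewrite h ?eqxx.
move: uNv; rewrite (@dot_unit_eq u (- v)) ?eqxx //.
  by rewrite dotNl dotNr opprK.
by rewrite dotNr h opprK.
Qed.

(* The determinant of the inner products of (x, y, z, u) with (x, y, z, v). *)
Lemma gram4 x y z u v :
  dot x x * (dot y y * (dot z z * dot u v - dot z v * dot u z)
           - dot y z * (dot z y * dot u v - dot z v * dot u y)
           + dot y v * (dot z y * dot u z - dot z z * dot u y))
  - dot x y * (dot y x * (dot z z * dot u v - dot z v * dot u z)
             - dot y z * (dot z x * dot u v - dot z v * dot u x)
             + dot y v * (dot z x * dot u z - dot z z * dot u x))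
  + dot x z * (dot y x * (dot z y * dot u v - dot z v * dot u y)
             - dot y y * (dot z x * dot u v - dot z v * dot u x)
             + dot y v * (dot z x * dot u y - dot z y * dot u x))
  - dot x v * (dot y x * (dot z y * dot u z - dot z z * dot u y)
             - dot y y * (dot z x * dot u z - dot z z * dot u x)
             + dot y z * (dot z x * dot u y - dot z y * dot u x)) = 0.
Proof. by rewrite !dotE; ring. Qed.

End Dot.

Section Frame.
Variables (R : realType).
Implicit Types (u v w x y z : 'rV[R]_3) (al be : R).

Definition frame al x y z :=
  [/\ dot x x = 1, dot y y = 1 & dot z z = 1] /\
  [/\ dot x y = al, dot x z = al & dot y z = al].

(** With G the Gram matrix of the frame, this is the bilinear form of (1 - al)(1 + 2 al) G^-1. *)
Definition frame_form al (a1 a2 a3 b1 b2 b3 : R) :=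
  (1 + 2 * al) * (a1 * b1 + a2 * b2 + a3 * b3)
  - al * (a1 + a2 + a3) * (b1 + b2 + b3).

(** For an equiangular triple the vanishing determinant of [gram4] has a factor 1 - al; cancelling
    it relates <u, v> to the inner products with the frame. *)
Lemma frame_dot al x y z u v : al != 1 -> frame al x y z ->
  frame_form al (dot u x) (dot u y) (dot u z) (dot v x) (dot v y) (dot v z)
  = (1 - al) * (1 + 2 * al) * dot u v.
Proof.
move=> al1 [[hx hy hz] [hxy hxz hyz]].
have al1' : 1 - al != 0 by rewrite subr_eq0 eq_sym.
apply: (mulfI al1'); apply/eqP; rewrite -subr_eq0 -oppr_eq0; apply/eqP.
have := gram4 x y z u v.
rewrite (dotC y x) (dotC z x) (dotC z y) hx hy hz hxy hxz hyz => <-.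
by rewrite (dotC x v) (dotC y v) (dotC z v) /frame_form; ring.
Qed.

End Frame.

Lemma dot_sign_sq (R : realType) (u v : 'rV[R]_3) (s s' : bool) :
  dot ((-1) ^+ s *: u) ((-1) ^+ s' *: v) ^+ 2 = dot u v ^+ 2.
Proof. by rewrite dotZl dotZr !exprMn !sqrr_sign !mul1r. Qed.

Lemma dot_sign_unit (R : realType) (u : 'rV[R]_3) (s : bool) :
  dot ((-1) ^+ s *: u) ((-1) ^+ s *: u) = dot u u.
Proof. by rewrite dotZl dotZr mulrA -signr_addb addbb mul1r. Qed.

(** * Lines of a two-angle system, encoded relative to a frame *)

Section System.
Variables (R : realType) (X : {fset 'rV[R]_3}) (al be : R).
Implicit Types (u v w x y z : 'rV[R]_3).

Definition two_angles :=
  [/\ forall x, x \in X -> dot x x = 1,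
      forall x y, x \in X -> y \in X -> x != y ->
        dot x y ^+ 2 = al ^+ 2 \/ dot x y ^+ 2 = be ^+ 2
    & [/\ al ^+ 2 < 1, be ^+ 2 < 1 & al ^+ 2 != be ^+ 2]].

(** Switching may move a vector out of [X] but not off its line: [inpm] accepts either unit vector
    of a line, and [rep] returns the one in [X]. *)
Definition inpm u := (u \in X) || (- u \in X).

Definition rep u := if u \in X then u else - u.

Lemma rep_in u : inpm u -> rep u \in X.
Proof. by rewrite /inpm /rep; case: ifP. Qed.

Lemma repE u : exists s : bool, u = (-1) ^+ s *: rep u.
Proof.
rewrite /rep; case: ifP => _; [exists false | exists true].
  by rewrite scale1r.
by rewrite expr1 scaleN1r opprK.
Qed.

Hypothesis HX : two_angles.

Lemma dot_rep u v : inpm u -> inpm v -> rep u != rep v ->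
  dot u v ^+ 2 = al ^+ 2 \/ dot u v ^+ 2 = be ^+ 2.
Proof.
have [_ hX _] := HX; move=> hu hv uv.
have [s ->] := repE u; have [s' ->] := repE v.
by rewrite dot_sign_sq; apply: hX; rewrite ?rep_in.
Qed.

Lemma dot_pm_unit u : inpm u -> dot u u = 1.
Proof.
have [hX _ _] := HX; case/orP => /hX //; by rewrite dotNl dotNr opprK.
Qed.

Lemma inpmN u : inpm (- u) = inpm u.
Proof. by rewrite /inpm opprK orbC. Qed.

Lemma inpm_in u : u \in X -> inpm u.
Proof. by rewrite /inpm => ->. Qed.

Lemma rep_id u : u \in X -> rep u = u.
Proof. by rewrite /rep => ->. Qed.

Section Frame.
Variables x1 x2 x3 : 'rV[R]_3.
Hypotheses (h1 : inpm x1) (h2 : inpm x2) (h3 : inpm x3).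
Hypothesis hF : frame al x1 x2 x3.
Hypothesis al_nd : 1 + 2 * al != 0.

Definition rest : seq 'rV[R]_3 :=
  [seq w <- X | w \notin [:: rep x1; rep x2; rep x3]].

Lemma rest_uniq : uniq rest.
Proof. exact/filter_uniq/fset_uniq. Qed.

Lemma size_rest : (#|` X| - 3 <= size rest)%N.
Proof.
rewrite leq_subLR -(count_predC [pred w | w \in [:: rep x1; rep x2; rep x3]]).
rewrite /rest size_filter leq_add2r.
rewrite -size_filter -[3%N]/(size [:: rep x1; rep x2; rep x3]).
apply: uniq_leq_size; first exact/filter_uniq/fset_uniq.
by move=> w; rewrite mem_filter => /andP[].
Qed.

Lemma mem_rest w : (w \in rest) =
  [&& w \in X, w != rep x1, w != rep x2 & w != rep x3].
Proof. by rewrite mem_filter !inE !negb_or andbC. Qed.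

Definition rval (c : bool * bool) : R := (-1) ^+ c.2 * (if c.1 then be else al).

Definition rcode (c : code) u : bool :=
  [&& dot u x1 == rval c.1.1, dot u x2 == rval c.1.2 & dot u x3 == rval c.2].

Lemma rvalP a : a ^+ 2 = al ^+ 2 \/ a ^+ 2 = be ^+ 2 -> exists c, a = rval c.
Proof.
case=> /eqP; rewrite eqf_sqr => /orP[] /eqP ->.
- by exists (false, false); rewrite /rval mul1r.
- by exists (false, true); rewrite /rval mulN1r.
- by exists (true, false); rewrite /rval mul1r.
- by exists (true, true); rewrite /rval mulN1r.
Qed.

Lemma codes_uniq : uniq codes.
Proof. by []. Qed.

Lemma mem_codes (c : code) : ~~ c.1.1.2 -> c \in codes.
Proof. by move: c => [[[[] []] [[] []]] [[] []]]. Qed.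

Lemma rcode_ex w : w \in rest ->
  exists2 c, c \in codes & rcode c w || rcode c (- w).
Proof.
rewrite mem_rest => /and4P[wX w1 w2 w3].
have dw y : inpm y -> w != rep y -> exists c, dot w y = rval c.
  by move=> hy wy; apply: rvalP; apply: dot_rep; rewrite ?(rep_id wX) //; apply: inpm_in.
have [c1 e1] := dw _ h1 w1; have [c2 e2] := dw _ h2 w2.
have [c3 e3] := dw _ h3 w3.
have flip (c : bool * bool) : - rval c = rval (c.1, ~~ c.2).
  by rewrite /rval /= signrN mulNr.
case s: c1.2.
  exists ((c1.1, ~~ c1.2), (c2.1, ~~ c2.2), (c3.1, ~~ c3.2)).
    by apply: mem_codes; rewrite /= s.
  by rewrite /rcode /= !dotNl e1 e2 e3 !flip !eqxx orbT.
exists (c1, c2, c3); first by apply: mem_codes; rewrite /= s.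
by rewrite /rcode /= e1 e2 e3 !eqxx.
Qed.

Definition enc w : code :=
  nth (false, false, (false, false), (false, false)) codes
    (find (fun c => rcode c w || rcode c (- w)) codes).

Definition orient w : 'rV[R]_3 := (-1) ^+ (~~ rcode (enc w) w) *: w.

Lemma enc_has w : w \in rest -> has (fun c => rcode c w || rcode c (- w)) codes.
Proof. by move=> /rcode_ex[c cc hc]; apply/hasP; exists c. Qed.

Lemma enc_mem w : w \in rest -> enc w \in codes.
Proof. by move=> /enc_has; rewrite has_find; apply: mem_nth. Qed.

Lemma rcode_enc w : w \in rest -> rcode (enc w) (orient w).
Proof.
move=> /enc_has/(nth_find (false, false, (false, false), (false, false))).
rewrite -/(enc w) /orient; case: (boolP (rcode (enc w) w)) => /= h.
  by rewrite scale1r.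
by rewrite expr1 scaleN1r.
Qed.

#[local] Opaque enc orient codes.

Definition code_form (c d : code) : R :=
  frame_form al (rval c.1.1) (rval c.1.2) (rval c.2)
    (rval d.1.1) (rval d.1.2) (rval d.2).

Lemma al_neq1 : al != 1.
Proof.
have [_ _ [h _ _]] := HX.
by apply/eqP => e; move: h; rewrite e expr1n ltxx.
Qed.

Lemma code_formE c d u v : rcode c u -> rcode d v ->
  code_form c d = (1 - al) * (1 + 2 * al) * dot u v.
Proof.
move=> /and3P[/eqP u1 /eqP u2 /eqP u3] /and3P[/eqP v1 /eqP v2 /eqP v3].
by rewrite /code_form -u1 -u2 -u3 -v1 -v2 -v3 (frame_dot _ _ al_neq1 hF).
Qed.

Lemma detF : (1 - al) * (1 + 2 * al) != 0.
Proof. by rewrite mulf_neq0 // subr_eq0 eq_sym al_neq1. Qed.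

#[local] Transparent orient.
Lemma orient_unit w : w \in rest -> dot (orient w) (orient w) = 1.
Proof.
rewrite mem_rest => /andP[wX _].
by rewrite /orient dot_sign_unit; apply/dot_pm_unit/inpm_in.
Qed.

Lemma orient_sq w w' : w \in rest -> w' \in rest -> w != w' ->
  dot (orient w) (orient w') ^+ 2 = al ^+ 2 \/
  dot (orient w) (orient w') ^+ 2 = be ^+ 2.
Proof.
have [_ hX _] := HX.
rewrite !mem_rest => /andP[wX _] /andP[wX' _] ww'.
by rewrite /orient dot_sign_sq; apply: hX.
Qed.

#[local] Opaque orient.
(** Vectors with the same code have the same inner products with everything, so two lines sharing a
    code would have inner product 1, whose square is neither al^2 nor be^2. *)
Lemma enc_inj : {in rest &, injective enc}.
Proof.
have [_ _ [ha hb _]] := HX.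
move=> w w' wr wr' e; apply/eqP/negPn/negP => ww'.
have : dot (orient w) (orient w') ^+ 2 = 1.
  have c1 := code_formE (rcode_enc wr) (rcode_enc wr).
  have := code_formE (rcode_enc wr) (rcode_enc wr').
  rewrite -e c1 (orient_unit wr) => /(mulfI detF) <-.
  by rewrite expr1n.
by case: (orient_sq wr wr' ww') => -> h; move: ha hb; rewrite h ltxx.
Qed.

Section Param.
Variables (t : R) (D A B g : seq Z) (fs : seq (seq Z)).
Hypothesis alE : ev A t = al * ev D t.
Hypothesis beE : ev B t = be * ev D t.

Lemma ev_val c : ev (pval A B c) t = rval c * ev D t.
Proof.
have zN1 : zr R (-1)%ZZ = -1 by [].
have z1 : zr R 1%ZZ = 1 by [].
rewrite /pval ev_scale /rval; case: c => [[] []];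
by rewrite /= ?alE ?beE ?zN1 ?z1 ?expr0 ?expr1 mulrA.
Qed.

Lemma ev_k : ev (pk D A) t = ev D t ^+ 2 * ((1 - al) * (1 + 2 * al)).
Proof. by rewrite /pk ev_mul ev_sub !ev_add alE; ring. Qed.

Definition pvec_of u (p : pvec) :=
  [/\ ev p.1.1 t = dot u x1 * ev D t, ev p.1.2 t = dot u x2 * ev D t
    & ev p.2 t = dot u x3 * ev D t].

Lemma pcodeP c u : rcode c u -> pvec_of u (pcode A B c).
Proof.
by move=> /and3P[/eqP u1 /eqP u2 /eqP u3]; split; rewrite /= ev_val ?u1 ?u2 ?u3.
Qed.

Lemma ev_ip u v p q : pvec_of u p -> pvec_of v q ->
  ev (pip D A p q) t = ev (pk D A) t * ev D t * dot u v.
Proof.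
move=> [u1 u2 u3] [v1 v2 v3].
have := frame_dot u v al_neq1 hF; rewrite /frame_form ev_k => h.
rewrite /pip ev_sub !ev_mul !ev_add !ev_mul u1 u2 u3 v1 v2 v3 alE.
transitivity (ev D t ^+ 3 * ((1 - al) * (1 + 2 * al) * dot u v)); last by ring.
by rewrite -h; ring.
Qed.

(** Ten lines less the three of the frame leave seven, hence the bound 7. The codes of all remaining
    lines satisfy the norm and pair equations at [t], so the search finds them. *)
Lemma frame_search : (forall f, f \in fs -> ev f t != 0) -> ev g t = 0 ->
  (10 <= #|` X|)%N ->
  exists2 l, l \in search D A B fs codes 7 g [::] & perm_eq l (map enc rest).
Proof.
move=> fsP g0 hX.
pose good c := c \in map enc rest.
have u : uniq (map enc rest) by rewrite (map_inj_in_uniq enc_inj) rest_uniq.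
have pe : perm_eq (catrev (filter good codes) [::]) (map enc rest).
  rewrite -/(rev _) perm_rev; apply: uniq_perm => //; first exact: (filter_uniq _ codes_uniq).
  move=> c; rewrite mem_filter /good andbC.
  by case: (boolP (c \in map _ _)) => [/mapP[w wr ->]|]; rewrite ?andbF // enc_mem.
exists (catrev (filter good codes) [::]) => //.
apply: (search_mem (R := R) (t := t)) => //; last 1 first.
- rewrite -size_filter -size_rev (perm_size pe) size_map (leq_trans _ size_rest) //.
  by rewrite leq_subRL // (leq_trans _ hX).
- move=> c /mapP[w wr ->]; have hw := pcodeP (rcode_enc wr).
  rewrite /pnrm ev_sub (ev_ip hw hw) orient_unit // ev_mul; ring.
- move=> c d /mapP[w wr ->] /mapP[w' wr' ->] cd.
  have hw := pcodeP (rcode_enc wr); have hw' := pcodeP (rcode_enc wr').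
  have ww' : w != w' by apply/eqP => e; rewrite e eqxx in cd.
  rewrite /ppair /psq ev_mul !ev_sub !ev_mul (ev_ip hw hw') alE beE.
  rewrite -[ev (psub D A) t * _](ev_mul t (psub D A)) -/(pk D A).
  case: (orient_sq wr wr' ww') => e; set K := ev (pk D A) t; set d' := ev D t.
    set P := dot _ _ in e *.
    have -> : K * d' * P * (K * d' * P) = (K * d') ^+ 2 * P ^+ 2 by ring.
    by rewrite e; ring.
  set P := dot _ _ in e *.
  have -> : K * d' * P * (K * d' * P) = (K * d') ^+ 2 * P ^+ 2 by ring.
  by rewrite e; ring.
Qed.

End Param.
End Frame.
End System.

Ltac zr_simpl :=
  rewrite /=;
  repeat match goal with
  | |- context [zr ?S (Zpos ?p)] =>
      let n := eval compute in (Pos.to_nat p) in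
      change (zr S (Zpos p)) with (n%:R : S)
  | |- context [zr ?S (Zneg ?p)] =>
      let n := eval compute in (Pos.to_nat p) in
      change (zr S (Zneg p)) with (- (n%:R) : S)
  | |- context [zr ?S Z0] => change (zr S Z0) with (0 : S)
  end.

(** * Excluding the curves of (al, be) *)

Section Cases.
Variables (R : realType) (X : {fset 'rV[R]_3}).
Implicit Types (al be t : R) (x y z u v w : 'rV[R]_3).

Definition framed al x y z :=
  [/\ inpm X x, inpm X y & inpm X z] /\ frame al x y z.

Lemma search_nil_absurd al be x y z t D A B g fs :
  two_angles X al be -> framed al x y z -> 1 + 2 * al != 0 -> (10 <= #|` X|)%N ->
  ev A t = al * ev D t -> ev B t = be * ev D t ->
  all (fun f => ev f t != 0) fs -> ev g t = 0 ->
  search D A B fs codes 7 g [::] = [::] -> False.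
Proof.
move=> HX [[h1 h2 h3] hF] nd hX aE bE /allP hfs g0 e.
have [l] := frame_search HX h1 h2 h3 hF nd aE bE hfs g0 hX.
by rewrite e.
Qed.

(** A fourth vector with inner products al, al, be with the frame has unit length only on this
    curve. *)
Lemma no_k4minus_pos al be x y z :
  two_angles X al be -> framed al x y z -> (10 <= #|` X|)%N ->
  1 + 2 * al != 0 -> (1 + al) * be = 4 * al ^+ 2 - al - 1 -> False.
Proof.
move=> HX hF hX nd e; have [_ _ [a1 b1 ab]] := HX.
have a0 : 1 + al != 0 by apply/eqP => h; have := a1; nra.
have am : al - 1 != 0 by apply/eqP => h; have := a1; nra.
have ab1 : be - al != 0.
  by apply: contraNneq ab => h; rewrite (_ : be = al) //; lra.
have ab2 : be + al != 0.
  by apply: contraNneq ab => h; rewrite (_ : be = - al) ?sqrrN //; lra.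
have az : al != 0 by apply/eqP => h; move: e b1; rewrite h; nra.
have a3 : 1 + 3 * al != 0.
  apply/eqP => h; have ha : al = - 3^-1 by lra.
  have hb : be = - 3^-1 by move: e; rewrite ha; lra.
  by move: ab; rewrite ha hb eqxx.
have a5 : 5 * al ^+ 2 - 1 != 0.
  apply/eqP => h; have : (1 + al) * (be + al) = 0 by lra.
  by move/eqP; rewrite mulf_eq0 (negPf a0) (negPf ab2).
(* The common denominator is 1 + t, and [g] is zero as no equation is imposed initially. The factors
   3t + 1 and 5t^2 - 1 belong to be = al and be = - al. *)
apply: (search_nil_absurd (t := al) (D := [:: 1; 1]%ZZ) (A := [:: 0; 1; 1]%ZZ)
  (B := [:: -1; -1; 4]%ZZ) (g := [::]) HX hF nd hX
  (fs := [:: [:: 1; 1]; [:: -1; 1]; [:: 1; 2]; [:: 0; 1]; [:: 1; 3]; [:: -1; 0; 5]]%ZZ));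
  last by vm_compute.
- by zr_simpl; lra.
- by zr_simpl; lra.
- zr_simpl; rewrite andbT; do !(apply/andP; split);
  [move: a0|move: am|move: nd|move: az|move: a3|move: a5];
  by apply: contraNneq => h; apply/eqP; lra.
- by [].
Qed.

(** This curve arises from a fourth vector with inner products al, - al and, up to sign, be. It puts
    (2 al, be) on the unit circle, which t = 2 al / (1 + be) parametrises rationally. At al^2 = 1/9
    one has be^2 = 5/9, as in the extremal system. *)
Lemma no_k4minus_neg al be x y z :
  two_angles X al be -> framed al x y z -> (10 <= #|` X|)%N ->
  1 + 2 * al != 0 -> 9 * al ^+ 2 != 1 -> be ^+ 2 = 1 - 4 * al ^+ 2 -> False.
Proof.
move=> HX hF hX nd a9 e; have [_ _ [a1 b1 ab]] := HX.
have b0 : 1 + be != 0 by apply/eqP => h; have := b1; nra.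
pose t := 2 * al / (1 + be).
have tb : t * (1 + be) = 2 * al by rewrite /t divfK.
clearbody t.
have az : al != 0 by apply/eqP => h; move: e b1; rewrite h; nra.
have tt : (1 + t ^+ 2) * (1 + be) = 2.
  apply: (mulIf b0); rewrite (_ : _ * _ * _ = (1 + be) ^+ 2 + (t * (1 + be)) ^+ 2);
    last by ring.
  by rewrite tb; nra.
have t0 : t != 0 by apply: contraNneq az => h; move: tb; rewrite h => tb; apply/eqP; lra.
have k0 : 1 + t ^+ 2 != 0 by apply: contra_eq_neq tt => ->; rewrite mul0r eq_sym pnatr_eq0.
have ta : t = al * (1 + t ^+ 2).
  apply: (mulIf b0); rewrite -mulrA tt tb; ring.
have tbe : 1 - t ^+ 2 = be * (1 + t ^+ 2).
  by lra.
have nz' (a b : R) : a != 0 -> b = a * (1 + t ^+ 2) -> b != 0.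
  by move=> ha ->; rewrite mulf_neq0.
(* The factor 1 + t belongs to al = -1/2, the quadratics t^2 + t - 1 and t^2 - t - 1 to be = al and
   be = - al, and the last two to al = 1/3 and al = -1/3. *)
apply: (search_nil_absurd (t := t) (D := [:: 1; 0; 1]%ZZ) (A := [:: 0; 1]%ZZ)
  (B := [:: 1; 0; -1]%ZZ) (g := [::]) HX hF nd hX
  (fs := [:: [:: 1; 0; 1]; [:: 1; 1]; [:: 0; 1]; [:: -1; 1; 1]; [:: -1; -1; 1];
             [:: 1; -3; 1]; [:: 1; 3; 1]]%ZZ)); last by vm_compute.
- by zr_simpl; lra.
- by zr_simpl; lra.
- zr_simpl; rewrite andbT; do !(apply/andP; split).
  + by apply: contraNneq k0 => h; apply/eqP; lra.
  + apply: contraNneq nd => h; have t1 : t = -1 by lra.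
    by move: ta; rewrite t1 => ta; apply/eqP; lra.
  + by apply: contraNneq t0 => h; apply/eqP; lra.
  + apply: (nz' (al - be)); last by lra.
    by apply: contraNneq ab => h; rewrite (_ : al = be) //; lra.
  + apply: (nz' (- al - be)); last by lra.
    by apply: contraNneq ab => h; rewrite (_ : al = - be) ?sqrrN //; lra.
  + apply: (nz' (1 - 3 * al)); last by lra.
    by apply: contraNneq a9 => h; rewrite (_ : al = 3^-1); [apply/eqP; field|lra].
  + apply: (nz' (1 + 3 * al)); last by lra.
    by apply: contraNneq a9 => h; rewrite (_ : al = - 3^-1); [apply/eqP; field|lra].
- by [].
Qed.

Lemma tetra_be al be x y z :
  two_angles X al be -> framed al x y z -> (10 <= #|` X|)%N ->
  al = - 3^-1 -> be ^+ 2 = 5 / 9.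
Proof.
move=> HX hF hX a3; have [_ _ [a1 b1 ab]] := HX.
have nd : 1 + 2 * al != 0 by rewrite a3; apply/eqP; lra.
apply/eqP/negPn/negP => b5.
(* The linear factors belong to be^2 = al^2 and be^2 = 1, and t^2 - 5 to be^2 = 5/9, which is
   assumed false. *)
apply: (search_nil_absurd (t := 3 * be) (D := [:: 3]%ZZ) (A := [:: -1]%ZZ)
  (B := [:: 0; 1]%ZZ) (g := [::]) HX hF nd hX
  (fs := [:: [:: 1; 1]; [:: -1; 1]; [:: 3; 1]; [:: -3; 1]; [:: -5; 0; 1]]%ZZ));
  last by vm_compute.
- by zr_simpl; rewrite a3; field.
- by zr_simpl; lra.
- zr_simpl; rewrite andbT; do !(apply/andP; split).
  + apply: contraNneq ab => h; rewrite a3 (_ : be = - 3^-1) //; lra.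
  + apply: contraNneq ab => h; rewrite a3 (_ : be = 3^-1) ?sqrrN //; lra.
  + by apply/eqP => h; have e : be = -1 by [lra]; move: b1; rewrite e sqrrN expr1n ltxx.
  + by apply/eqP => h; have e : be = 1 by [lra]; move: b1; rewrite e expr1n ltxx.
  + by apply: contraNneq b5 => h; apply/eqP; lra.
- by [].
Qed.

Lemma no_icosahedral_search al be x y z :
  two_angles X al be -> framed al x y z -> (10 <= #|` X|)%N ->
  5 * al ^+ 2 = 1 ->
  2 * al = 5 * be ^+ 2 - 2 * be - 1 \/ 2 * al = 3 * be ^+ 2 - 1 -> False.
Proof.
move=> HX hF hX a5 h; have [_ _ [a1 b1 ab]] := HX.
have nd : 1 + 2 * al != 0.
  by apply/eqP => e; have ea : al = - 2^-1 by [lra]; move: a5; rewrite ea; lra.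
have fsP : all (fun f => ev f be != 0) [:: [:: 1; 1]; [:: -1; 1]; [:: -1; 0; 5]]%ZZ.
  zr_simpl; rewrite andbT; do !(apply/andP; split).
  + by apply/eqP => h'; have e : be = -1 by [lra]; move: b1; rewrite e sqrrN expr1n ltxx.
  + by apply/eqP => h'; have e : be = 1 by [lra]; move: b1; rewrite e expr1n ltxx.
  + by apply: contraNneq ab => h'; apply/eqP; lra.
case: h => h.
  (* In both branches al = A / 2, and [g] is 5 A^2 - 4, that is, 5 al^2 = 1 written in be. *)
  apply: (search_nil_absurd (t := be) (D := [:: 2]%ZZ) (A := [:: -1; -2; 5]%ZZ)
    (B := [:: 0; 2]%ZZ) (g := [:: 1; 20; -30; -100; 125]%ZZ) HX hF nd hX _ _ fsP);
    last by vm_compute.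
  - by zr_simpl; lra.
  - by zr_simpl; lra.
  - have ea : al = (5 * be ^+ 2 - 2 * be - 1) / 2 by lra.
    by zr_simpl; move: a5; rewrite ea; lra.
apply: (search_nil_absurd (t := be) (D := [:: 2]%ZZ) (A := [:: -1; 0; 3]%ZZ)
  (B := [:: 0; 2]%ZZ) (g := [:: 1; 0; -30; 0; 45]%ZZ) HX hF nd hX _ _ fsP);
  last by vm_compute.
- by zr_simpl; lra.
- by zr_simpl; lra.
- have ea : al = (3 * be ^+ 2 - 1) / 2 by lra.
  by zr_simpl; move: a5; rewrite ea; lra.
Qed.

End Cases.

(** * The icosahedral angle al^2 = 1/5 *)

Section Icosahedral.
Variables (R : realType) (X : {fset 'rV[R]_3}).
Implicit Types (al be t : R) (x y z u v w : 'rV[R]_3).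

(** Only four codes use al alone, while at least seven lines remain and have distinct codes. *)
Lemma rest_mixed al be x y z :
  two_angles X al be -> framed X al x y z -> (10 <= #|` X|)%N ->
  1 + 2 * al != 0 ->
  exists c u, [/\ rcode al be x y z c u, dot u u = 1
    & [|| c.1.1.1, c.1.2.1 | c.2.1]].
Proof.
move=> HX [[h1 h2 h3] hF] hX nd.
case: (boolP (has (fun w => let c := enc al be x y z w in
  [|| c.1.1.1, c.1.2.1 | c.2.1]) (rest X x y z))) => [/hasP[w wr hw]|/hasPn hn].
  exists (enc al be x y z w), (orient al be x y z w); split => //.
    exact: rcode_enc wr.
  exact: orient_unit wr.
have : (size (rest X x y z) <=
   size [seq c <- codes | ~~ [|| c.1.1.1, c.1.2.1 | c.2.1]])%N.
  rewrite -(size_map (enc al be x y z)); apply: uniq_leq_size.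
    by rewrite (map_inj_in_uniq (enc_inj HX h1 h2 h3 hF nd)) rest_uniq.
  move=> c /mapP[w wr ->]; rewrite mem_filter hn //=.
  by apply: (enc_mem HX h1 h2 h3).
rewrite (_ : size (filter _ _) = 4%N) // => h4.
have := leq_trans (size_rest X x y z) h4.
by rewrite leq_subLR leqNgt (leq_trans _ hX).
Qed.

Lemma no_icosahedral al be x y z :
  two_angles X al be -> framed X al x y z -> (10 <= #|` X|)%N ->
  5 * al ^+ 2 = 1 -> False.
Proof.
move=> HX hF hX a5; have [_ _ [a1 b1 ab]] := HX.
have nd : 1 + 2 * al != 0.
  by apply/eqP => e; have ea : al = - 2^-1 by [lra]; move: a5; rewrite ea; lra.
have [c [u [hc hu mc]]] := rest_mixed HX hF hX nd.
have := code_formE HX (proj2 hF) hc hc; rewrite hu mulr1 => H.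
(* Multiples of 5 al^2 = 1, with which [lra] lowers powers of al below. *)
have p1 : al * (5 * al ^+ 2) = al by rewrite a5 mulr1.
have p2 b : b * (5 * al ^+ 2) = b by rewrite a5 mulr1.
have S b : b ^+ 2 = be ^+ 2 -> two_angles X al b.
  by by move=> e; case: HX => ? ? [? ? ?]; split; rewrite ?e.
have am : 1 - al != 0 by apply/eqP => h; have := a1; nra.
have ap : 1 + al != 0 by apply/eqP => h; have := a1; nra.
have ab' : be ^+ 2 - al ^+ 2 != 0 by rewrite subr_eq0 eq_sym.
(* Unit length of [u], sorted by the number of inner products equal to be up to sign. The suffix [o]
   marks opposite signs: of the two al when there is one be, among the be otherwise. Modulo 5 al^2 =
   1 only [E2] and [E3] are left to the search; the others are contradictory. *)
have E1 b : b ^+ 2 = be ^+ 2 ->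
    (1 + al) * b ^+ 2 - 4 * al ^+ 2 * b + 4 * al ^+ 2 - 1 - al = 0 -> False.
  move=> e h; have := p2 b => p2b.
  have : (b - 1) * ((1 + al) * (b + al)) = 0 by lra.
  move=> /eqP; rewrite !mulf_eq0 (negPf ap) subr_eq0 addr_eq0 => /orP[]/eqP eb.
    by move: b1; rewrite -e eb expr1n ltxx.
  by move: ab; rewrite -e eb sqrrN eqxx.
have E1o : (1 + al) * be ^+ 2 + 4 * al ^+ 3 + 4 * al ^+ 2 - 1 - al = 0 -> False.
  move=> h; have : (1 + al) * (be ^+ 2 - al ^+ 2) = 0 by lra.
  by move/eqP; rewrite mulf_eq0 (negPf ap) (negPf ab').
have E2 b : b ^+ 2 = be ^+ 2 ->
    2 * b ^+ 2 - 4 * al ^+ 2 * b + al ^+ 3 + 3 * al ^+ 2 - al - 1 = 0 -> False.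
  move=> e h; have := p2 b => p2b.
  by apply: (no_icosahedral_search (S b e) hF hX a5); left; lra.
have E2o : 2 * be ^+ 2 * (1 + 2 * al) + al ^+ 3 + 3 * al ^+ 2 - al - 1 = 0 -> False.
  move=> h; have : (1 + 2 * al) * (be ^+ 2 - al ^+ 2) = 0 by lra.
  by move/eqP; rewrite mulf_eq0 (negPf nd) (negPf ab').
have E3 : 3 * be ^+ 2 * (1 - al) - (1 - al) * (1 + 2 * al) = 0 -> False.
  move=> h; apply: (no_icosahedral_search HX hF hX a5); right.
  by apply: (mulfI am); lra.
have E3o : be ^+ 2 * (3 + 5 * al) - (1 - al) * (1 + 2 * al) = 0 -> False.
  move=> h; have : (3 + 5 * al) * (be ^+ 2 - al ^+ 2) = 0 by lra.
  move/eqP; rewrite mulf_eq0 (negPf ab') orbF => /eqP e.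
  have ea : al = - (3 / 5) by lra.
  by move: a5; rewrite ea; lra.
have bN : (- be) ^+ 2 = be ^+ 2 by rewrite sqrrN.
move: H => /eqP; rewrite -subr_eq0 => /eqP.
move: mc; case: c {hc} => [[[[] []] [[] []]] [[] []]] // _;
  rewrite /code_form /frame_form /rval /= ?expr0 ?expr1 => H;
  first [ by apply: (E1 be) => //; rewrite -H; ring
        | by apply: (E1 (- be)) => //; rewrite -H; ring
        | by apply: E1o; rewrite -H; ring
        | by apply: (E2 be) => //; rewrite -H; ring
        | by apply: (E2 (- be)) => //; rewrite -H; ring
        | by apply: E2o; rewrite -H; ring
        | by apply: E3; rewrite -H; ring | by apply: E3o; rewrite -H; ring ].
Qed.

End Icosahedral.

(** * A Ramsey bound: a monochromatic K4 minus an edge on ten points *)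

Section ColouredK4.
Variables (T : eqType) (e : rel T) (s : seq T).
Hypothesis eC : symmetric e.

(** The pair [r1], [r2] is the missing edge. *)
Definition k4minus (b : bool) (p q r1 r2 : T) :=
  [/\ [/\ p \in s, q \in s, r1 \in s & r2 \in s],
      [/\ p != q, p != r1 & p != r2] /\ [/\ q != r1, q != r2 & r1 != r2]
    & [/\ e p q = b, e p r1 = b, e p r2 = b, e q r1 = b & e q r2 = b]].

Ltac k4 b p q r1 r2 :=
  exists b, p, q, r1, r2; do !split => //; by [rewrite eq_sym | rewrite eC].

(** Two of the edges among [z1], [z2], [z3] share a colour; they close up with [v] if it is [c], and
    with [y] otherwise. *)
Lemma k4minus_three (c : bool) v y z1 z2 z3 :
  [/\ v \in s, y \in s, z1 \in s, z2 \in s & z3 \in s] ->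
  [/\ v != z1, v != z2 & v != z3] -> [/\ y != z1, y != z2 & y != z3] ->
  [/\ z1 != z2, z1 != z3 & z2 != z3] ->
  [/\ e v z1 = c, e v z2 = c & e v z3 = c] ->
  [/\ e y z1 = ~~ c, e y z2 = ~~ c & e y z3 = ~~ c] ->
  exists b p q r1 r2, k4minus b p q r1 r2.
Proof.
move=> [? ? ? ? ?] [? ? ?] [? ? ?] [? ? ?] [? ? ?] [? ? ?].
have cb (b c' : bool) : b = c' \/ b = ~~ c' by case: b c' => [] []; auto.
case: (cb (e z1 z2) c) => ?; case: (cb (e z1 z3) c) => ?; case: (cb (e z2 z3) c) => ?;
  first [ k4 c v z1 z2 z3 | k4 c v z2 z1 z3 | k4 c v z3 z1 z2
        | k4 (~~ c) y z1 z2 z3 | k4 (~~ c) y z2 z1 z3 | k4 (~~ c) y z3 z1 z2 ].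
Qed.

(* Five neighbours of v have the same colour c.  If one of them has two c-neighbours
   among the others, these four vertices will do; otherwise the other colour contains
   K5 minus a matching. *)
Lemma k4minus_exists : uniq s -> (10 <= size s)%N ->
  exists b p q r1 r2, k4minus b p q r1 r2.
Proof.
move=> us hs.
have [v vs] : exists v, v \in s by case: s hs => // v s' _; exists v; rewrite mem_head.
pose N c := [seq w <- s | (w != v) && (e v w == c)].
have [c hc] : exists c, (5 <= size (N c))%N.
  have : (9 <= size (N true) + size (N false))%N.
    have h : (size s = size (N true) + size (N false) + count_mem v s)%N.
      rewrite !size_filter -!sumn_count.
      elim: s => //= w s' ->; case: (w == v); case: (e v w) => //=; lia.
    by move: hs; rewrite h (count_uniq_mem _ us) vs addn1.
  case: (leqP 5 (size (N true))) => [|h1 h2]; first by exists true.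
  by exists false; lia.
have uN : uniq (N c) by exact: filter_uniq.
have mN w : w \in N c -> [/\ w \in s, v != w & e v w = c].
  by rewrite mem_filter eq_sym => /andP[/andP[-> /eqP ->] ->].
case: (N c) hc uN mN => [|y1 [|y2 [|y3 [|y4 [|y5 l]]]]] //= _.
rewrite !inE !negb_or -!andbA => hu hm.
have [[? ? ?] [? ? ?] [? ? ?] [? ? ?] [? ? ?]] : [/\ [/\ y1 \in s, v != y1 & e v y1 = c],
    [/\ y2 \in s, v != y2 & e v y2 = c], [/\ y3 \in s, v != y3 & e v y3 = c],
    [/\ y4 \in s, v != y4 & e v y4 = c] & [/\ y5 \in s, v != y5 & e v y5 = c]].
  by split; apply: hm; rewrite !inE eqxx ?orbT.
move: hu; do 14![case/andP => ?]; move=> hu.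
have cb (b c' : bool) : b = c' \/ b = ~~ c' by case: b c' => [] []; auto.
(* It suffices to examine [y1]: two edges of colour [c] finish together with [v]; otherwise three
   have the other colour and [k4minus_three] applies. *)
case: (cb (e y1 y2) c) => ?; case: (cb (e y1 y3) c) => ?;
  case: (cb (e y1 y4) c) => ?; case: (cb (e y1 y5) c) => ?;
  first [ k4 c v y1 y2 y3 | k4 c v y1 y2 y4 | k4 c v y1 y2 y5
        | k4 c v y1 y3 y4 | k4 c v y1 y3 y5 | k4 c v y1 y4 y5
        | by apply: (@k4minus_three c v y1 y2 y3 y4)
        | by apply: (@k4minus_three c v y1 y2 y3 y5)
        | by apply: (@k4minus_three c v y1 y2 y4 y5)
        | by apply: (@k4minus_three c v y1 y3 y4 y5) ].
Qed.

End ColouredK4.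

(** * Reduction to al = -1/3 and be^2 = 5/9 *)

Section Tetrahedral.
Variables (R : realType) (X : {fset 'rV[R]_3}).
Implicit Types (al be t c : R) (x y z u v w : 'rV[R]_3).

Lemma two_angles_sq al be al' be' : al ^+ 2 = al' ^+ 2 -> be ^+ 2 = be' ^+ 2 ->
  two_angles X al be -> two_angles X al' be'.
Proof. by move=> ea eb [? ? [? ? ?]]; split; rewrite -?ea -?eb. Qed.

Lemma two_anglesC al be : two_angles X al be -> two_angles X be al.
Proof.
move=> [? h [? ? ?]]; split => //; last by split=> //; rewrite eq_sym.
by move=> x y hx hy xy; case: (h x y hx hy xy); auto.
Qed.

Lemma sign_fix (a c : R) : a ^+ 2 = c ^+ 2 -> exists s : bool, (-1) ^+ s * a = c.
Proof.
move/eqP; rewrite eqf_sqr => /orP[] /eqP ->; [exists false|exists true].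
  by rewrite mul1r.
by rewrite mulN1r opprK.
Qed.

Lemma inpm_sign u (s : bool) : inpm X u -> inpm X ((-1) ^+ s *: u).
Proof. by case: s; rewrite ?scale1r // scaleN1r inpmN. Qed.

(* Switching normalises the signs in an equiangular triple up to the sign of al,
   and those of a fourth vector up to one sign. *)
Lemma normal_k4minus c x y z w :
  (forall u, u \in X -> dot u u = 1) ->
  x \in X -> y \in X -> z \in X -> w \in X ->
  dot x y ^+ 2 = c ^+ 2 -> dot x z ^+ 2 = c ^+ 2 -> dot y z ^+ 2 = c ^+ 2 ->
  dot x w ^+ 2 = c ^+ 2 -> dot y w ^+ 2 = c ^+ 2 ->
  exists al x' y' z' w', [/\ al ^+ 2 = c ^+ 2, framed X al x' y' z', inpm X w',
    dot x' w' = al & [/\ dot y' w' ^+ 2 = al ^+ 2 & dot z' w' ^+ 2 = dot z w ^+ 2]].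
Proof.
move=> hu xX yX zX wX hxy hxz hyz hxw hyw.
have [sy ey] := sign_fix hxy; have [sz ez] := sign_fix hxz.
pose y1 := (-1) ^+ sy *: y; pose z1 := (-1) ^+ sz *: z.
have uy : dot y1 y1 = 1 by rewrite dot_sign_unit hu.
have uz : dot z1 z1 = 1 by rewrite dot_sign_unit hu.
have iy : inpm X y1 by rewrite inpm_sign // inpm_in.
have iz : inpm X z1 by rewrite inpm_sign // inpm_in.
have hyz1 : dot y1 z1 ^+ 2 = c ^+ 2 by rewrite dot_sign_sq.
have exy : dot x y1 = c by rewrite dotZr.
have exz : dot x z1 = c by rewrite dotZr.
(* If <y1, z1> = - c, negating [x] makes all three inner products - c. *)
have [al [x1 [ix ux a2 e1 [e2 e3 e4]]]] : exists al x1,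
    [/\ inpm X x1, dot x1 x1 = 1, al ^+ 2 = c ^+ 2, dot x1 y1 = al
      & [/\ dot x1 z1 = al, dot y1 z1 = al & dot x1 w ^+ 2 = c ^+ 2]].
  move/eqP: hyz1; rewrite eqf_sqr => /orP[] /eqP e.
    by exists c, x; split => //; rewrite ?inpm_in ?hu.
  exists (- c), (- x); split; rewrite ?inpmN ?inpm_in ?dotNl ?dotNr ?opprK ?hu ?exy ?sqrrN //.
  by rewrite exz e.
have [sw ew] : exists sw : bool, (-1) ^+ sw * dot x1 w = al.
  by apply: sign_fix; rewrite e4 a2.
exists al, x1, y1, z1, ((-1) ^+ sw *: w); split => //.
- by rewrite inpm_sign // inpm_in.
- by rewrite dotZr.
- split; first by rewrite a2 dot_sign_sq.
  by rewrite dot_sign_sq.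
Qed.

(** Unit length of [w] gives an equation between al and d = <z, w> that factors. Each allowed d
    leads to al = 1/3 or -1/3, to the icosahedral case, or to a curve excluded by [no_k4minus_pos]
    or [no_k4minus_neg]. *)
Lemma tetrahedral_frame al be x y z w :
  (10 <= #|` X|)%N -> two_angles X al be -> framed X al x y z -> inpm X w ->
  dot x w = al -> dot y w ^+ 2 = al ^+ 2 ->
  dot z w ^+ 2 = al ^+ 2 \/ dot z w ^+ 2 = be ^+ 2 ->
  exists x' y' z', framed X (- 3^-1) x' y' z' /\
    two_angles X (- 3^-1) (Num.sqrt 5 / 3).
Proof.
move=> hX HX hF iw xw yw zw; have [hu hp [a1 b1 ab]] := HX.
have be5 : (Num.sqrt 5 / 3 : R) ^+ 2 = 5 / 9.
  by rewrite exprMn sqr_sqrtr ?ler0n //; field.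
have fin x' y' z' al' be' : two_angles X al' be' -> framed X al' x' y' z' ->
    al' = - 3^-1 -> exists x' y' z', framed X (- 3^-1) x' y' z' /\
    two_angles X (- 3^-1) (Num.sqrt 5 / 3).
  move=> H F e; exists x', y', z'; rewrite -e; split=> //.
  by apply: (two_angles_sq _ _ H) => //; rewrite (tetra_be H F hX e) be5.
have an : 1 - al != 0 by apply/eqP => h; have := a1; nra.
have ap : 1 + al != 0 by apply/eqP => h; have := a1; nra.
have uw := dot_pm_unit HX iw.
have hD := frame_dot w w (al_neq1 HX) (proj2 hF).
move: hD; rewrite uw (dotC w x) (dotC w y) (dotC w z) xw /frame_form.
set d := dot z w in zw *.
have d1 : d ^+ 2 < 1 by case: zw => ->.
move/eqP: yw; rewrite eqf_sqr => /orP[] /eqP yw; rewrite yw => hD.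
  have : (d - 1) * ((1 + al) * d - (4 * al ^+ 2 - al - 1)) = 0 by lra.
  move=> /eqP; rewrite mulf_eq0 subr_eq0 => /orP[/eqP d2|/eqP ed].
    by move: d1; rewrite d2 expr1n ltxx.
  case: zw => [/eqP|zw].
    rewrite eqf_sqr => /orP[] /eqP dal.
      have : (1 - al) * (1 + 3 * al) = 0 by move: ed; rewrite dal; lra.
      move/eqP; rewrite mulf_eq0 (negPf an) /= => /eqP a3.
      by apply: (fin _ _ _ _ _ HX hF); lra.
    by case: (no_icosahedral HX hF hX); move: ed; rewrite dal; lra.
  have HX' : two_angles X al d by apply: two_angles_sq HX.
  case: (no_k4minus_pos HX' hF hX); last by lra.
  apply/eqP => e; have ea : al = - 2^-1 by lra.
  have e1 : d = 1 by move: ed; rewrite ea; lra.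
  by move: d1; rewrite e1 expr1n ltxx.
have : (1 + al) * (d ^+ 2 + 4 * al ^+ 2 - 1) = 0 by lra.
move=> /eqP; rewrite mulf_eq0 (negPf ap) /= => /eqP ed.
case: zw => zw.
  by case: (no_icosahedral HX hF hX); lra.
have eb : be ^+ 2 = 1 - 4 * al ^+ 2 by lra.
have [[ix iy iz] [[ux uy uz] [exy exz eyz]]] := hF.
(* Since <y, w> = - al, this is a frame for - al; it settles al = 1/3 and al = -1/2. *)
have hF' : framed X (- al) (- x) y w.
  by split; split; rewrite ?inpmN ?dotNl ?dotNr ?opprK ?exy ?xw.
have HX' : two_angles X (- al) be by apply: two_angles_sq HX; rewrite ?sqrrN.
have eb' : be ^+ 2 = 1 - 4 * (- al) ^+ 2 by rewrite sqrrN.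
case: (eqVneq al (- 3^-1)) => [e|n3]; first exact: fin HX hF e.
case: (eqVneq al 3^-1) => [e|n3'].
  by apply: (fin _ _ _ _ _ HX' hF'); rewrite e.
have n9 : 9 * al ^+ 2 != 1.
  apply/eqP => h; have : (al - 3^-1) * (al - (- 3^-1)) = 0 by lra.
  by move/eqP; rewrite mulf_eq0 !subr_eq0 (negPf n3) (negPf n3').
case: (eqVneq (1 + 2 * al) 0) => [e|nd]; last by case: (no_k4minus_neg HX hF hX nd n9 eb).
case: (no_k4minus_neg HX' hF' hX _ _ eb'); last by rewrite sqrrN.
by apply/eqP; lra.
Qed.

Lemma tetrahedral_frame_exists c c' : (10 <= #|` X|)%N -> two_angles X c c' ->
  exists x' y' z', framed X (- 3^-1) x' y' z' /\
    two_angles X (- 3^-1) (Num.sqrt 5 / 3).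
Proof.
move=> hX HX; have [hu hp [_ _ cc]] := HX.
pose e (x y : 'rV[R]_3) := dot x y ^+ 2 == c ^+ 2.
have eC : symmetric e by move=> x y; rewrite /e dotC.
have [b [p [q [r1 [r2 [[pX qX r1X r2X] [[pq p1 p2] [q1 q2 r12]] [e1 e2 e3 e4 e5]]]]]]] :=
  k4minus_exists eC (fset_uniq X) hX.
have [a [a' [HX' he]]] : exists a a', two_angles X a a' /\
    (forall x y, x \in X -> y \in X -> x != y -> e x y = b -> dot x y ^+ 2 = a ^+ 2).
  case: b {e1 e2 e3 e4 e5}.
    by exists c, c'; split => // x y _ _ _ /eqP.
  exists c', c; split; first exact: two_anglesC.
  by move=> x y hx hy xy /eqP h; case: (hp x y hx hy xy).
have [al [x [y [z [w [ea hF iw hxw [hyw hzw]]]]]]] := normal_k4minus hu pX qX r1X r2X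
  (he _ _ pX qX pq e1) (he _ _ pX r1X p1 e2) (he _ _ qX r1X q1 e4)
  (he _ _ pX r2X p2 e3) (he _ _ qX r2X q2 e5).
have HX2 : two_angles X al a' by apply: two_angles_sq HX'.
apply: (tetrahedral_frame hX HX2 hF iw hxw hyw).
by rewrite hzw; case: HX2 => _ h _; apply: h.
Qed.

End Tetrahedral.

(** * The surviving sets and the matrix C *)

(* The remainder modulo t^2 - 5, constant coefficient first. *)
Fixpoint red5 (p : seq Z) : Z * Z :=
  if p is a :: q then (Z.add a (Z.mul (red5 q).2 5%ZZ), (red5 q).1)
  else (0%ZZ, 0%ZZ).

(* Rows of 3 * C(1/3, t/3) as polynomials in t. *)
Definition Ctab : seq (seq (seq Z)) :=
  let u := [:: 3]%ZZ in
  let a := [:: 1]%ZZ in let a' := [:: -1]%ZZ in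
  let b := [:: 0; 1]%ZZ in let b' := [:: 0; -1]%ZZ in
  [:: [::  u;  a;  a;  a;  a;  a;  a;  b;  b;  b];
      [::  a;  u;  a; a'; a';  b; b';  a; a';  b];
      [::  a;  a;  u;  b; b'; a'; a'; a';  a;  b];
      [::  a; a';  b;  u; a'; b';  a; a';  b;  a];
      [::  a; a'; b'; a';  u;  a;  b;  b;  a; a'];
      [::  a;  b; a'; b';  a;  u; a';  b; a';  a];
      [::  a; b'; a';  a;  b; a';  u;  a;  b; a'];
      [::  b;  a; a'; a';  b;  b;  a;  u;  a;  a];
      [::  b; a';  a;  b;  a; a';  b;  a;  u;  a];
      [::  b;  b;  b;  a; a';  a; a';  a;  a;  u]].

Definition Cpol (i j : nat) : seq Z := nth [::] (nth [::] Ctab i) j.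

(** Entries of [q] stand for 12 times inner products: 12 is pk D for D = 3, A = -1, and also arises
    from doubled coordinates of vectors of squared length 3. As [Cpol] holds 3 C, the factor is
    4. *)
Definition gram_check (q : nat -> nat -> seq Z) : bool :=
  all (fun i => all (fun j => red5 (psub (q i j) (pscale 4%ZZ (Cpol i j))) == (0%ZZ, 0%ZZ))
    (iota 0 10)) (iota 0 10).

Section GramC.
Variable R : realType.
Local Notation t := (Num.sqrt 5 : R).
Local Notation C := (Cmx (1 / 3) (t / 3)).

Lemma t2 : t ^+ 2 = 5.
Proof. by rewrite sqr_sqrtr ?ler0n. Qed.

Lemma ev_red5 p : ev p t = zr R (red5 p).1 + zr R (red5 p).2 * t.
Proof.
elim: p => [|a p IH] /=; first by rewrite /zr /= mul0r addr0.
rewrite zrD zrM IH (_ : zr R 5%ZZ = t ^+ 2); last by rewrite t2.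
by ring.
Qed.

Lemma CmxE (i j : 'I_10) : C i j = ev (Cpol i j) t / 3.
Proof.
have e1 : ev [:: 3]%ZZ t / 3 = 1 by zr_simpl; field.
have ea : ev [:: 1]%ZZ t / 3 = 1 / 3 by zr_simpl; field.
have ea' : ev [:: -1]%ZZ t / 3 = - (1 / 3) by zr_simpl; field.
have eb : ev [:: 0; 1]%ZZ t / 3 = t / 3 by zr_simpl; field.
have eb' : ev [:: 0; -1]%ZZ t / 3 = - (t / 3) by zr_simpl; field.
have szr : size (nth [::] Ctab i) = 10%N by case: i => [[|[|[|[|[|[|[|[|[|[|i]]]]]]]]]]].
rewrite mxE -(nth_map _ 0 (fun p => ev p t / 3)) ?szr ?ltn_ord //.
congr (nth 0 _ j).
rewrite -(nth_map _ [::] (map (fun p => ev p t / 3))) ?ltn_ord //.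
congr (nth [::] _ i).
by rewrite /Ctab /map e1 ea ea' eb eb'.
Qed.

Lemma gram_checkP q (x : 'I_10 -> 'rV[R]_3) : gram_check q ->
  (forall i j : 'I_10, ev (q i j) t = 12 * dot (x i) (x j)) -> gram x = C.
Proof.
move=> /allP hq hx; apply/matrixP => i j; rewrite mxE.
have mi (k : 'I_10) : (k : nat) \in iota 0 10 by rewrite mem_iota ltn_ord.
have /allP/(_ _ (mi j))/eqP h := hq _ (mi i).
have := ev_red5 (psub (q i j) (pscale 4%ZZ (Cpol i j))).
rewrite h ev_sub ev_scale hx (_ : zr R 4%ZZ = 4) // /zr /= CmxE => e.
by apply: (mulfI (_ : (12 : R) != 0)); rewrite ?pnatr_eq0 //; lra.
Qed.

Lemma Cmx_diag (i : 'I_10) : C i i = 1.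
Proof.
have /allP h : all (fun k => Cpol k k == [:: 3]%ZZ) (iota 0 10) by [].
rewrite CmxE (eqP (h i _)); last by rewrite mem_iota ltn_ord.
by zr_simpl; field.
Qed.

Lemma Cmx_off (i j : 'I_10) : i != j -> C i j ^+ 2 = 1 / 9 \/ C i j ^+ 2 = 5 / 9.
Proof.
have /allP h : all (fun k => all (fun l => (k == l) ||
  (Cpol k l \in [:: [:: 1]; [:: -1]; [:: 0; 1]; [:: 0; -1]]%ZZ)) (iota 0 10)) (iota 0 10).
  by vm_compute.
have mi (k : 'I_10) : (k : nat) \in iota 0 10 by rewrite mem_iota ltn_ord.
have /allP/(_ _ (mi j)) := h _ (mi i).
rewrite -val_eqE /= CmxE => /orP[-> //|+ _].
have := t2; rewrite !inE => e /or4P[] /eqP ->; zr_simpl.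
- by left; field.
- by left; field.
- by right; transitivity (t ^+ 2 / 9); [field | rewrite e].
- by right; transitivity (t ^+ 2 / 9); [field | rewrite e].
Qed.

End GramC.

(** Codes of the seven lines completing the frame, the last one chosen by the search coming
    first. *)
Definition clique1 : seq code := [::
  (false, false, (true, true), (false, true));
  (false, false, (true, false), (true, true));
  (false, false, (false, true), (true, false));
  (false, false, (false, false), (false, false));
  (true, false, (true, true), (false, false));
  (true, false, (false, true), (true, true));
  (true, false, (false, false), (false, true))].

(* The image of clique1 under the symmetry exchanging the last two frame vectors. *)
Definition clique2 : seq code := [::
  (false, false, (true, true), (true, false));
  (false, false, (true, false), (false, true));
  (false, false, (false, true), (true, true));
  (false, false, (false, false), (false, false));
  (true, false, (true, true), (false, true));
  (true, false, (false, true), (false, false));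
  (true, false, (false, false), (true, true))].

(** Here t = 3 be, and starting from t^2 - 5 imposes be^2 = 5/9. *)
Lemma search_tetrahedral :
  search [:: 3]%ZZ [:: -1]%ZZ [:: 0; 1]%ZZ [::] codes 7 [:: -5; 0; 1]%ZZ [::]
  = [:: clique1; clique2].
Proof. by vm_compute. Qed.

(* Position in the clique (after the three frame vectors) and sign of the
   vectors realising the successive rows of C. *)
Definition cert1 : seq (nat * bool) :=
  [:: (0, false); (1, true); (5, true); (2, true); (6, true); (4, true); (3, true);
      (9, false); (8, false); (7, false)]%N.
Definition cert2 : seq (nat * bool) :=
  [:: (0, false); (1, true); (5, true); (6, true); (2, true); (4, true); (3, true);
      (9, false); (8, false); (7, false)]%N.

(** Vectors are given by 3 times their inner products with the frame, so the frame itself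
    contributes the rows of 3 times its Gram matrix. *)
Definition frame_pvecs (l : seq code) : seq pvec :=
  [:: ([:: 3], [:: -1], [:: -1]); ([:: -1], [:: 3], [:: -1]);
      ([:: -1], [:: -1], [:: 3])]%ZZ
  ++ map (pcode [:: -1]%ZZ [:: 0; 1]%ZZ) l.

Definition pv0 : pvec := ([::], [::], [::]).

Definition cert_gram (l : seq code) (ct : seq (nat * bool)) (i j : nat) : seq Z :=
  let c := nth (0%N, false) ct i in
  let d := nth (0%N, false) ct j in
  pscale (if c.2 (+) d.2 then (-1)%ZZ else 1%ZZ)
    (pip [:: 3]%ZZ [:: -1]%ZZ (nth pv0 (frame_pvecs l) c.1) (nth pv0 (frame_pvecs l) d.1)).

Lemma cert1P : gram_check (cert_gram clique1 cert1).
Proof. by vm_compute. Qed.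

Lemma cert2P : gram_check (cert_gram clique2 cert2).
Proof. by vm_compute. Qed.

Section Realise.
Variables (R : realType) (X : {fset 'rV[R]_3}) (x y z : 'rV[R]_3).
Local Notation t := (Num.sqrt 5 : R).
Local Notation C := (Cmx (1 / 3) (t / 3)).
Local Notation al := (- 3^-1 : R).
Local Notation be := (t / 3).
Hypotheses (HX : two_angles X al be) (hF : framed X al x y z).
Hypothesis hX : (10 <= #|` X|)%N.

Lemma rep_opp w : w \in X -> - w \in X -> False.
Proof.
have [hu hp [a1 b1 _]] := HX; move=> wX nX.
have wn : w != - w.
  apply/eqP => e; have := hu _ wX; rewrite {2}e dotNr hu // => /eqP.
  by rewrite eqNr oner_eq0.
have : dot w (- w) ^+ 2 = 1 by rewrite dotNr hu // sqrrN expr1n.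
by case: (hp _ _ wX nX wn) => -> h; move: a1 b1; rewrite h ltxx.
Qed.

Lemma rep_sign w (s : bool) : w \in X -> rep X ((-1) ^+ s *: w) = w.
Proof.
move=> wX; case: s; last by rewrite scale1r rep_id.
rewrite scaleN1r /rep opprK.
by case: ifP => // /(rep_opp wX).
Qed.

(** The codes determine all inner products through [ev_ip], so the Gram matrix can be computed from
    [l]; [ct] arranges it as C. *)
Lemma realise_clique (l : seq code) (ct : seq (nat * bool)) :
  perm_eq l (map (enc al be x y z) (rest X x y z)) -> size l = 7%N ->
  perm_eq (map fst ct) (iota 0 10) -> gram_check (cert_gram l ct) ->
  exists (v : 'I_10 -> 'rV[R]_3) (s : 'I_10 -> bool),
    X = [fset v i | i : 'I_10] /\ gram (fun i => (-1) ^+ s i *: v i) = C.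
Proof.
move=> hl sl hct hg.
have [[ix iy iz] hFr] := hF.
have [[ux uy uz] [exy exz eyz]] := hFr.
have nd : 1 + 2 * al != 0 by apply/eqP; lra.
set E := enc al be x y z in hl; set O := orient al be x y z.
(* [dec] inverts the encoding on [l], where the default 0 is not reached. *)
pose dec c := nth 0 (rest X x y z) (index c (map E (rest X x y z))).
have decP c : c \in l -> dec c \in rest X x y z /\ E (dec c) = c.
  rewrite (perm_mem hl) => cl; have := cl; rewrite -index_mem size_map => ci.
  split; first exact: mem_nth.
  by rewrite -(nth_map _ (E 0)) // nth_index.
have decE w : w \in rest X x y z -> dec (E w) = w.
  move=> wr; have el : E w \in l by rewrite (perm_mem hl) map_f.
  have [dr de] := decP _ el.
  exact: (enc_inj HX ix iy iz hFr nd).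
pose U := [:: x; y; z] ++ map (fun c => O (dec c)) l.
have sU : size U = 10%N by rewrite /= size_map sl.
have Upm k : (k < 10)%N -> inpm X (nth 0 U k).
  rewrite -sU => /(mem_nth 0); rewrite !inE => /or4P[/eqP->|/eqP->|/eqP->|] //.
  move=> /mapP[c cl ->]; have [] := decP _ cl; rewrite mem_rest => /andP[dX _] _.
  by rewrite /O /orient inpm_sign // inpm_in.
have aE : ev [:: -1]%ZZ t = al * ev [:: 3]%ZZ t by zr_simpl; field.
have bE : ev [:: 0; 1]%ZZ t = be * ev [:: 3]%ZZ t by zr_simpl; field.
have Upv k : (k < 10)%N ->
    pvec_of x y z t [:: 3]%ZZ (nth 0 U k) (nth pv0 (frame_pvecs l) k).
  case: k => [|[|[|k]]] hk.
  - by split; rewrite /= ?ux ?(dotC y x) ?exy ?exz; zr_simpl; field.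
  - by split; rewrite /= ?uy ?(dotC y x) ?exy ?eyz; zr_simpl; field.
  - by split; rewrite /= ?uz ?(dotC z x) ?(dotC z y) ?eyz ?exz; zr_simpl; field.
  have kl : (k < size l)%N by rewrite sl.
  rewrite /= (nth_map (false, false, (false, false), (false, false))) //.
  rewrite (nth_map (false, false, (false, false), (false, false))) //.
  have [dr de] := decP _ (mem_nth (false, false, (false, false), (false, false)) kl).
  rewrite -{2}de; apply: (pcodeP aE bE).
  exact: (rcode_enc HX ix iy iz).
pose c i := nth (0%N, false) ct i.
have sct : size ct = 10%N by rewrite -(size_map fst) (perm_size hct) size_iota.
have ci (i : 'I_10) : ((c i).1 < 10)%N.
  have : (c i).1 \in map fst ct by rewrite map_f // mem_nth // sct.
  by rewrite (perm_mem hct) mem_iota.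
pose u (i : 'I_10) := nth 0 U (c i).1.
(* The listed vectors must lie in [X], so the sign flips whenever [u i] does not. *)
exists (fun i => rep X (u i)), (fun i : 'I_10 => (c i).2 (+) (u i \notin X)).
have uE (i : 'I_10) : (-1) ^+ ((c i).2 (+) (u i \notin X)) *: rep X (u i) = (-1) ^+ (c i).2 *: u i.
  rewrite /rep; case: ifP => _; rewrite ?addbF //=.
  by rewrite addbT signrN scalerN scaleNr opprK.
split.
  apply/fsetP => w; apply/idP/imfsetP => /= [wX|[i _ ->]]; last first.
    by apply: rep_in; exact: Upm.
  have [k hk wk] : exists2 k, (k < 10)%N & w = rep X (nth 0 U k).
    case: (boolP (w \in rest X x y z)) => [wr|].
      have el : E w \in l by rewrite (perm_mem hl) map_f.
      exists (3 + index (E w) l)%N; first by rewrite -sU /= !ltnS size_map index_mem.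
      rewrite /= (nth_map (false, false, (false, false), (false, false))) ?index_mem //.
      by rewrite nth_index // decE // rep_sign.
    rewrite mem_rest wX /= !negb_and !negbK => /or3P[] /eqP ->;
      [by exists 0%N|by exists 1%N|by exists 2%N].
  have : k \in map fst ct by rewrite (perm_mem hct) mem_iota.
  case/(nthP 0%N) => i; rewrite size_map sct => hi hik.
  exists (Ordinal hi) => //; rewrite wk /u /c /=; congr (rep X (nth 0 U _)).
  by rewrite -hik (nth_map (0%N, false)) ?sct.
apply: (gram_checkP hg) => i j; rewrite !uE /cert_gram -/(c i) -/(c j).
rewrite ev_scale (ev_ip HX hFr aE (Upv _ (ci i)) (Upv _ (ci j))) (ev_k aE).
rewrite dotZl dotZr -/(u i) -/(u j).
have -> : zr R (if (c i).2 (+) (c j).2 then (-1)%ZZ else 1%ZZ)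
    = (-1) ^+ (c i).2 * (-1) ^+ (c j).2.
  by rewrite -signr_addb; case: (_ (+) _).
by zr_simpl; field.
Qed.

Lemma realise : exists (v : 'I_10 -> 'rV[R]_3) (s : 'I_10 -> bool),
  X = [fset v i | i : 'I_10] /\ gram (fun i => (-1) ^+ s i *: v i) = C.
Proof.
have [[ix iy iz] hFr] := hF.
have nd : 1 + 2 * al != 0 by apply/eqP; lra.
have aE : ev [:: -1]%ZZ t = al * ev [:: 3]%ZZ t by zr_simpl; field.
have bE : ev [:: 0; 1]%ZZ t = be * ev [:: 3]%ZZ t by zr_simpl; field.
have g0 : ev [:: -5; 0; 1]%ZZ t = 0 by zr_simpl; have := t2 R; lra.
have [//|l] := frame_search (fs := [::]) HX ix iy iz hFr nd aE bE _ g0 hX.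
rewrite search_tetrahedral !inE => /orP[] /eqP -> hl.
  by apply: (realise_clique hl _ _ cert1P).
by apply: (realise_clique hl _ _ cert2P).
Qed.

End Realise.

(** * From biangular systems to two angles, and the bound ten *)

Section Biangular.
Variables (R : realType) (X : {fset 'rV[R]_3}).

Lemma biangular_dot_sq x y : biangular X -> x \in X -> y \in X -> x != y ->
  dot x y ^+ 2 \in [fset g ^+ 2 | g in inner_products X] /\ dot x y ^+ 2 < 1.
Proof.
move=> [hu h1 _] xX yX xy.
have hin : dot x y \in inner_products X.
  apply/imfsetP; exists (x, y) => //=.
  by rewrite !inE /= xX yX.
split; first by apply/imfsetP; exists (dot x y).
apply: dot_unit_lt1; rewrite ?hu //.
apply: contraNneq h1 => e; move: hin; rewrite {1}e dotNl hu //.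
Qed.

Lemma biangular_two_angles : biangular X -> exists c c', two_angles X c c'.
Proof.
move=> hX; have [hu h1 h2] := hX.
set S := [fset g ^+ 2 | g in inner_products X] in h2.
have hS s : s \in S -> 0 <= s < 1.
  move=> /imfsetP[g /= /imfsetP[[x y] /=]].
  rewrite !inE /= => /andP[/andP[xX yX] xy] -> ->.
  by rewrite sqr_ge0; have [_ ->] := biangular_dot_sq hX xX yX xy.
suff [a [b [a01 b01 ab hab]]] : exists a b, [/\ 0 <= a < 1, 0 <= b < 1, a != b
    & forall s, s \in S -> s = a \/ s = b].
  exists (Num.sqrt a), (Num.sqrt b); have [/andP[a0 a1] /andP[b0 b1]] := (a01, b01).
  split=> //; rewrite !sqr_sqrtr //.
  by move=> x y xX yX xy; have [hs _] := biangular_dot_sq hX xX yX xy; apply: hab.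
have mS s : s \in S = (s \in enum_fset S) by [].
case: (enum_fset S) (fset_uniq S) h2 hS mS => [|a [|b [|? ?]]] //= u _ hS mS.
(* With fewer than two squares, arbitrary distinct values in [0, 1) fill up: 0 and 1/4 here, (a + 1)
   / 2 in the next case. *)
- exists 0, (1 / 4); split; [by apply/andP; split; lra | by apply/andP; split; lra | |].
    by apply/eqP; lra.
  by move=> s; rewrite mS.
- have /andP[a0 a1] : 0 <= a < 1 by apply: hS; rewrite mS inE.
  exists a, ((a + 1) / 2); split; [by apply/andP; split; lra | by apply/andP; split; lra | |].
    by apply/eqP; lra.
  by move=> s; rewrite mS inE => /eqP ->; left.
- exists a, b; split; [by apply: hS; rewrite mS !inE eqxx | | |].
    by apply: hS; rewrite mS !inE eqxx orbT.
    by move: u; rewrite inE andbT.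
  by move=> s; rewrite mS !inE => /orP[] /eqP ->; auto.
Qed.

Lemma biangular_gram : biangular X -> (10 <= #|` X|)%N ->
  exists (x : 'I_10 -> 'rV[R]_3) (s : 'I_10 -> bool),
    X = [fset x i | i : 'I_10] /\
    gram (fun i => (-1) ^+ s i *: x i) = Cmx (1 / 3) (Num.sqrt 5 / 3).
Proof.
move=> hX h10; have [c [c' H]] := biangular_two_angles hX.
have [x [y [z [hF H']]]] := tetrahedral_frame_exists h10 H.
exact: realise H' hF h10.
Qed.

(** [biangular_gram] assumes only at least ten vectors, yet enumerates [X] by ten indices. *)
Lemma biangular_bound : biangular X -> (#|` X| <= 10)%N.
Proof.
move=> hX; rewrite leqNgt; apply/negP => h.
have [x [s [e _]]] := biangular_gram hX (ltnW h).
move: h; rewrite e ltnNge (leq_trans (leq_imfset_card _ _ _)) //.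
by rewrite -cardE card_ord.
Qed.

End Biangular.

(** * Isometry of systems with Gram matrix C *)

Section Isometry.
Variable R : realType.
Local Notation C := (Cmx (1 / 3) (Num.sqrt 5 / 3 : R)).

(** The first three vectors of C(1/3, sqrt 5/3) have pairwise inner products 1/3 and serve as a
    basis. *)
Definition basis_mx (x : 'I_10 -> 'rV[R]_3) : 'M[R]_3 :=
  \matrix_(i, j) x (widen_ord (isT : (3 <= 10)%N) i) 0 j.

Lemma mul_basis_trE (x : 'I_10 -> 'rV[R]_3) (u : 'rV[R]_3) j :
  (u *m (basis_mx x)^T) 0 j = dot u (x (widen_ord (isT : (3 <= 10)%N) j)).
Proof. by rewrite /dot !mxE; apply: eq_bigr => k _; rewrite !mxE. Qed.

Lemma basis_gram (x : 'I_10 -> 'rV[R]_3) : gram x = C ->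
  basis_mx x *m (basis_mx x)^T = \matrix_(i, j) (if i == j then 1 else 1 / 3).
Proof.
move=> hx; apply/matrixP => i j.
transitivity (gram x (widen_ord (isT : (3 <= 10)%N) i) (widen_ord (isT : (3 <= 10)%N) j)).
  by rewrite !mxE /dot !mxE; apply: eq_bigr => k _; rewrite !mxE.
rewrite hx !mxE.
by case: i j => [[|[|[|?]]] ?] [[|[|[|?]]] ?].
Qed.

Lemma basis_unit (x : 'I_10 -> 'rV[R]_3) : gram x = C -> basis_mx x \in unitmx.
Proof.
move=> hx.
(* The inverse of the matrix with diagonal 1 and all other entries 1/3. *)
pose N : 'M[R]_3 := \matrix_(i, j) (if i == j then 6 / 5 else - (3 / 10)).
have /mulmx1_unit[] // : basis_mx x *m ((basis_mx x)^T *m N) = 1%:M.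
rewrite mulmxA basis_gram //; apply/matrixP => i j.
rewrite !mxE !big_ord_recl big_ord0 !mxE.
by case: i j => [[|[|[|?]]] ?] [[|[|[|?]]] ?] //=; field.
Qed.

(** The change of basis is orthogonal because both bases have the same Gram matrix; the other
    vectors follow, being determined by their inner products with the basis. *)
Lemma gram_isometry (x y : 'I_10 -> 'rV[R]_3) : gram x = C -> gram y = C ->
  exists Q : 'M[R]_3, Q *m Q^T = 1%:M /\ forall i, x i *m Q = y i.
Proof.
move=> hx hy; have ux := basis_unit hx; have uy := basis_unit hy.
exists (invmx (basis_mx x) *m basis_mx y); split.
  rewrite trmx_mul mulmxA -[_ *m _ *m (basis_mx y)^T]mulmxA.
  rewrite (basis_gram hy) -(basis_gram hx) mulmxA mulVmx // mul1mx.
  by rewrite trmx_inv mulmxV // unitmx_tr.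
move=> i; have uyT : (basis_mx y)^T \in unitmx by rewrite unitmx_tr.
apply: (can_inj (mulmxK uyT)).
rewrite -!mulmxA (basis_gram hy) -(basis_gram hx) (mulmxA (invmx _)) mulVmx // mul1mx.
apply/rowP => j; rewrite !mul_basis_trE.
have := congr1 (fun M : 'M[R]_10 => M i (widen_ord (isT : (3 <= 10)%N) j))
  (etrans hx (esym hy)).
by rewrite !mxE.
Qed.

Lemma biangular_isometric (X Y : {fset 'rV[R]_3}) :
  biangular X -> #|` X| = 10%N -> biangular Y -> #|` Y| = 10%N ->
  isometric_systems X Y.
Proof.
move=> hX cX hY cY.
have [x [s [eX gx]]] := biangular_gram hX (eq_leq (esym cX)).
have [y [s' [eY gy]]] := biangular_gram hY (eq_leq (esym cY)).
have [Q [hQ xQ]] := gram_isometry gx gy.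
have [hYu hYn _] := hY.
have sgn i : x i *m Q = (-1) ^+ (s i (+) s' i) *: y i.
  have := congr1 (fun v => (-1) ^+ s i *: v) (xQ i).
  by rewrite -scalemxAl !scalerA -!signr_addb addbb scale1r.
have yY i : y i \in Y by rewrite eY; apply/imfsetP; exists i.
have nY v : v \in Y -> - v \notin Y.
  move=> vY; apply/negP => nvY.
  have vn : v != - v.
    apply/eqP => e; have := hYu _ vY; rewrite {2}e dotNr hYu // => /eqP.
    by rewrite eqNr oner_eq0.
  have [_] := biangular_dot_sq hY vY nvY vn.
  by rewrite dotNr hYu // sqrrN expr1n ltxx.
(* [Y] contains no antipodal pair, so membership in [Y] decides between [y i] and [- y i]. *)
exists Q, (fun v => v *m Q \notin Y); split=> //.
have key i : (-1) ^+ (x i *m Q \notin Y) *: (x i *m Q) = y i.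
  rewrite sgn; case: (s i (+) s' i).
    by rewrite expr1 scaleN1r (nY _ (yY i)) scaleN1r opprK.
  by rewrite scale1r yY scale1r.
apply/fsetP => w; apply/idP/imfsetP => /=.
  rewrite {1}eY => /imfsetP[i _ ->]; exists (x i); last by rewrite key.
  by rewrite eX; apply/imfsetP; exists i.
by move=> [v + ->]; rewrite {1}eX => /imfsetP[i _ ->]; rewrite key.
Qed.

Lemma gram_inj (x : 'I_10 -> 'rV[R]_3) : gram x = C -> forall i j, i != j ->
  [/\ dot (x i) (x i) = 1, dot (x i) (x j) ^+ 2 != 1
    & dot (x i) (x j) ^+ 2 = 1 / 9 \/ dot (x i) (x j) ^+ 2 = 5 / 9].
Proof.
move=> hx i j ij.
have e k l : dot (x k) (x l) = C k l by rewrite -hx mxE.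
rewrite !e Cmx_diag; split=> //; last exact: Cmx_off.
by case: (Cmx_off R ij) => ->; apply/eqP; lra.
Qed.

Lemma gram_biangular (x : 'I_10 -> 'rV[R]_3) : gram x = C ->
  biangular [fset x i | i : 'I_10] /\ #|` [fset x i | i : 'I_10]| = 10%N.
Proof.
move=> hx; have u i : dot (x i) (x i) = 1.
  by have := Cmx_diag R i; rewrite -hx mxE.
have ip a : a \in inner_products [fset x i | i : 'I_10] ->
    exists i j, i != j /\ a = dot (x i) (x j).
  move=> /imfsetP[[v w] /=].
  rewrite !inE /= => /andP[/andP[/imfsetP[i _ ->] /imfsetP[j _ ->]] xy] ->.
  by exists i, j; split=> //; apply: contra_neq xy => ->.
have inj : injective x.
  move=> i j e; apply/eqP/negPn/negP => ij.
  by have [_ + _] := gram_inj hx ij; rewrite -e u expr1n eqxx.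
split; last first.
  rewrite card_imfset //= -cardE card_ord //.
split.
- by move=> _ /imfsetP[i _ ->].
- apply/negP => /ip[i [j [ij e]]]; have [_ + _] := gram_inj hx ij.
  by rewrite -e sqrrN expr1n eqxx.
apply: (@leq_trans #|` [fset (1 / 9 : R); 5 / 9]|); last by rewrite cardfs2; case: (_ == _).
apply: fsubset_leq_card; apply/fsubsetP => _ /imfsetP[g /= /ip[i [j [ij ->]]] ->].
by have [_ _ [] ->] := gram_inj hx ij; rewrite !inE eqxx ?orbT.
Qed.

End Isometry.

(** * The dodecahedron *)

(* Doubled coordinates, as polynomials in sqrt 5, of ten pairwise non-antipodal
   vertices, ordered so that their Gram matrix is 3 * C. *)
Definition dodec_pvecs : seq pvec := [::
  ([:: 2], [:: 2], [:: 2]);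
  ([:: 2], [:: 2], [:: -2]);
  ([:: 1; -1], [:: 1; 1], [::]);
  ([:: -2], [:: 2], [:: 2]);
  ([:: 2], [:: -2], [:: 2]);
  ([:: 1; 1], [::], [:: 1; -1]);
  ([::], [:: 1; -1], [:: 1; 1]);
  ([:: 1; 1], [::], [:: -1; 1]);
  ([::], [:: -1; 1], [:: 1; 1]);
  ([:: -1; 1], [:: 1; 1], [::])]%ZZ.

Definition dodec_gram (i j : nat) : seq Z :=
  let p := nth pv0 dodec_pvecs i in let q := nth pv0 dodec_pvecs j in
  padd (padd (pmul p.1.1 q.1.1) (pmul p.1.2 q.1.2)) (pmul p.2 q.2).

Section Dodecahedron.
Variable R : realType.
Local Notation t := (Num.sqrt 5 : R).
Local Notation C := (Cmx (1 / 3) (t / 3)).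
Local Notation V := (dodecahedron_vertices R).

Definition dodec_vertex (i : nat) : 'rV[R]_3 :=
  let p := nth pv0 dodec_pvecs i in
  vec3 (ev p.1.1 t / 2) (ev p.1.2 t / 2) (ev p.2 t / 2).

Definition dodec_unit (i : 'I_10) : 'rV[R]_3 := (Num.sqrt 3)^-1 *: dodec_vertex i.

Lemma vec3E (a b c a' b' c' : R) :
  dot (vec3 a b c) (vec3 a' b' c') = a * a' + b * b' + c * c'.
Proof. by rewrite dotE !mxE. Qed.

Lemma dodec_gramE : gram dodec_unit = C.
Proof.
apply: (@gram_checkP R dodec_gram); first by vm_compute.
move=> i j; rewrite /dodec_unit dotZl dotZr vec3E.
have s2 : (Num.sqrt 3 : R)^-1 * (Num.sqrt 3)^-1 = 3^-1.
  by rewrite -expr2 exprVn sqr_sqrtr ?ler0n.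
rewrite (mulrA _^-1 _^-1) s2.
by rewrite /dodec_gram !ev_add !ev_mul; field.
Qed.

Lemma sqrt3_neq0 : (Num.sqrt 3 : R)^-1 != 0.
Proof. by rewrite invr_eq0 sqrtr_eq0 -ltNge ltr0n. Qed.

Lemma line_scale (a : R) (v : 'rV[R]_3) : a != 0 -> (<[a *: v]> = <[v]>)%VS.
Proof.
move=> a0; apply/eqP; rewrite eqEsubv -!memvE memvZ ?memv_line //=.
by rewrite -{1}[v]scale1r -(mulVf a0) -scalerA memvZ ?memv_line.
Qed.

Lemma goldenV : (golden R)^-1 = (t - 1) / 2.
Proof.
have h := t2 R; have g0 : 0 <= t by apply: sqrtr_ge0.
apply: (mulfI (_ : golden R != 0)).
  by rewrite /golden; apply/eqP; lra.
rewrite mulfV; last by rewrite /golden; apply/eqP; lra.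
by rewrite /golden; lra.
Qed.

Lemma vec3Z (a x y z : R) : a *: vec3 x y z = vec3 (a * x) (a * y) (a * z).
Proof. by apply/rowP => -[[|[|[|?]]] ?]; rewrite !mxE. Qed.

Lemma vertexP v : reflect
  [\/ exists a b c : bool, v = vec3 ((-1) ^+ a) ((-1) ^+ b) ((-1) ^+ c),
      exists a b : bool, v = vec3 0 ((-1) ^+ a * ((t - 1) / 2)) ((-1) ^+ b * ((1 + t) / 2)),
      exists a b : bool, v = vec3 ((-1) ^+ b * ((1 + t) / 2)) 0 ((-1) ^+ a * ((t - 1) / 2))
    | exists a b : bool, v = vec3 ((-1) ^+ a * ((t - 1) / 2)) ((-1) ^+ b * ((1 + t) / 2)) 0]
  (v \in V).
Proof.
rewrite /dodecahedron_vertices goldenV !mem_cat; apply: (iffP or4P); case.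
- by move=> /mapP[[[a b] c] _ ->]; constructor 1; exists a, b, c.
- by move=> /mapP[[a b] _ ->]; constructor 2; exists a, b.
- by move=> /mapP[[a b] _ ->]; constructor 3; exists a, b.
- by move=> /mapP[[a b] _ ->]; constructor 4; exists a, b.
- by move=> [a [b [c ->]]]; constructor 1; apply/mapP; exists (a, b, c); rewrite ?mem_enum.
- by move=> [a [b ->]]; constructor 2; apply/mapP; exists (a, b); rewrite ?mem_enum.
- by move=> [a [b ->]]; constructor 3; apply/mapP; exists (a, b); rewrite ?mem_enum.
- by move=> [a [b ->]]; constructor 4; apply/mapP; exists (a, b); rewrite ?mem_enum.
Qed.

Ltac vec3_tac := rewrite /dodec_vertex ?vec3Z; congr (vec3 _ _ _);
  rewrite ?expr0 ?expr1; zr_simpl; field.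

Lemma dodec_vertex_mem (i : 'I_10) : dodec_vertex i \in V.
Proof.
apply/vertexP; case: i => [[|[|[|[|[|[|[|[|[|[|i]]]]]]]]]] hi] //=.
- by constructor 1; exists false, false, false; vec3_tac.
- by constructor 1; exists false, false, true; vec3_tac.
- by constructor 4; exists true, false; vec3_tac.
- by constructor 1; exists true, false, false; vec3_tac.
- by constructor 1; exists false, true, false; vec3_tac.
- by constructor 3; exists true, false; vec3_tac.
- by constructor 2; exists true, false; vec3_tac.
- by constructor 3; exists false, false; vec3_tac.
- by constructor 2; exists false, false; vec3_tac.
- by constructor 4; exists false, false; vec3_tac.
Qed.

Lemma vertex_pm v : v \in V ->
  exists (i : 'I_10) (s : bool), v = (-1) ^+ s *: dodec_vertex i.
Proof.
have ex (k : nat) (s : bool) w : (k < 10)%N -> w = (-1) ^+ s *: dodec_vertex k ->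
    exists (i : 'I_10) (s : bool), w = (-1) ^+ s *: dodec_vertex i.
  by move=> hk ->; exists (Ordinal hk), s.
move=> /vertexP[[[] [[] [[] ->]]]|[[] [[] ->]]|[[] [[] ->]]|[[] [[] ->]]].
- by apply: (ex 0%N true) => //; vec3_tac.
- by apply: (ex 1%N true) => //; vec3_tac.
- by apply: (ex 4%N true) => //; vec3_tac.
- by apply: (ex 3%N false) => //; vec3_tac.
- by apply: (ex 3%N true) => //; vec3_tac.
- by apply: (ex 4%N false) => //; vec3_tac.
- by apply: (ex 1%N false) => //; vec3_tac.
- by apply: (ex 0%N false) => //; vec3_tac.
- by apply: (ex 8%N true) => //; vec3_tac.
- by apply: (ex 6%N false) => //; vec3_tac.
- by apply: (ex 6%N true) => //; vec3_tac.
- by apply: (ex 8%N false) => //; vec3_tac.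
- by apply: (ex 7%N true) => //; vec3_tac.
- by apply: (ex 5%N false) => //; vec3_tac.
- by apply: (ex 5%N true) => //; vec3_tac.
- by apply: (ex 7%N false) => //; vec3_tac.
- by apply: (ex 9%N true) => //; vec3_tac.
- by apply: (ex 2%N false) => //; vec3_tac.
- by apply: (ex 2%N true) => //; vec3_tac.
- by apply: (ex 9%N false) => //; vec3_tac.
Qed.

Lemma diagonalsE :
  dodecahedron_diagonals R = [fset <[dodec_unit i]>%VS | i : 'I_10].
Proof.
have lineE (i : 'I_10) : (<[dodec_unit i]> = <[dodec_vertex i]>)%VS.
  exact: line_scale sqrt3_neq0.
apply/fsetP => L; apply/imfsetP/imfsetP => /= [[v /vertex_pm[i [s ->]] ->]|[i _ ->]].
  by exists i; rewrite // lineE line_scale // signr_eq0.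
by exists (dodec_vertex i); rewrite ?dodec_vertex_mem // lineE.
Qed.

(** Unit vectors on a common line have squared inner product 1, which C rules out off the
    diagonal. *)
Lemma card_diagonals : #|` dodecahedron_diagonals R| = 10%N.
Proof.
rewrite diagonalsE card_imfset /=; first by rewrite -cardE card_ord.
move=> i j /= e; apply/eqP/negPn/negP => ij.
have [ui + _] := gram_inj dodec_gramE ij; case/negP.
have uj : dot (dodec_unit j) (dodec_unit j) = 1.
  by have [] : _ := gram_inj dodec_gramE (contra_neq (@esym _ _ _) ij).
have : dodec_unit i \in <[dodec_unit j]>%VS by rewrite -e memv_line.
case/vlineP => k hk.
have kk : k * (k * 1) = 1 by rewrite -{1}uj -(dotZr k) -dotZl -hk ui.
by rewrite hk (dotZl k) uj mulr1 expr2 -[X in _ * X]mulr1 kk.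
Qed.

End Dodecahedron.
Unset Implicit Arguments.

Theorem theorem4p3 (R : realType) :
  [/\ (exists X : {fset 'rV[R]_3}, biangular X /\ #|` X| = 10%N)
        /\ (forall X : {fset 'rV[R]_3}, biangular X -> (#|` X| <= 10)%N),
      forall X Y : {fset 'rV[R]_3},
        biangular X -> #|` X| = 10%N -> biangular Y -> #|` Y| = 10%N ->
        isometric_systems X Y,
      forall X : {fset 'rV[R]_3}, biangular X -> #|` X| = 10%N ->
        exists (x : 'I_10 -> 'rV[R]_3) (s : 'I_10 -> bool),
          X = [fset x i | i : 'I_10] /\
          gram (fun i => (-1) ^+ s i *: x i) = Cmx (1 / 3) (Num.sqrt 5 / 3)
    & #|` dodecahedron_diagonals R| = 10%N /\
      forall x : 'I_10 -> 'rV[R]_3,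
        gram x = Cmx (1 / 3) (Num.sqrt 5 / 3) ->
        exists Q : 'M[R]_3, Q *m Q^T = 1%:M /\
          [fset <[x i *m Q]>%VS | i : 'I_10] = dodecahedron_diagonals R].
Proof.
split.
- split; last exact: biangular_bound.
  by exists [fset dodec_unit R i | i : 'I_10]; apply/gram_biangular/dodec_gramE.
- exact: biangular_isometric.
- by move=> X hX cX; apply: biangular_gram; rewrite ?cX.
split; first exact: card_diagonals.
move=> x hx; have [Q [hQ xQ]] := gram_isometry hx (dodec_gramE R).
exists Q; split=> //; rewrite diagonalsE.
by apply/fsetP => L; apply/imfsetP/imfsetP => -[i _ ->]; exists i; rewrite ?xQ.
Qed.
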